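(* Let $\alpha$ be an automorphism of a unital $C^*$-algebra $A$ with the property that for any finite subset $F$ of $A$ and for any $m\in\mathbb{N}$ and $\epsilon>0$ there are projections $e_0,e_1,\dots,e_{m-1}$ in $A$ and a partial isometry $p$ in $A$ such that (1) $\|e_ie_j\|<\epsilon$ for $i,j=0,1,\dots,m-1$, $i\neq j$; (2) $\|\alpha(e_i)-e_{i+1}\|<\epsilon$ for $i=0,1,\dots,m-1$, where $e_m=e_0$; (3) $\left\|p^*p-\left(1-\sum_{i=0}^{m-1}e_i\right)\right\|<\epsilon$ and $\|pp^*-e_0\|<\epsilon$; (4) $\|[x,y]\|<\epsilon$ for any $x\in F$ and $y\in\{e_0,p\}$. Then $\alpha$ has the Rohlin property.
   Context: $\mathbb{N}$ denotes the positive integers, $[x,y]=xy-yx$, and $1$ is the identity of $A$. Rohlin property: an automorphism $\alpha$ of a unital $C^*$-algebra $A$ has the Rohlin property if for any $k\in\mathbb{N}$ there are $m\in\mathbb{N}$ and positive integers $k_0,\dots,k_{m-1}\geq k$ such that: for any finite subset $F$ of $A$ and any $\varepsilon>0$ there are projections $e_{i,j}$, $i=0,\dots,m-1$, $j=0,\dots,k_i-1$, in $A$ with (1) $\sum_{i=0}^{m-1}\sum_{j=0}^{k_i-1}e_{i,j}=1$; (2) $\|\alpha(e_{i,j})-e_{i,j+1}\|<\varepsilon$; (3) $\|[x,e_{i,j}]\|<\varepsilon$; for all $i=0,\dots,m-1$, $j=0,\dots,k_i-1$ and $x\in F$, where $e_{i,k_i}=e_{i,0}$. *)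

(* Defs.v *)
From HB Require Import structures.
From mathcomp Require Import all_boot all_order all_algebra.
From mathcomp Require Import all_classical all_reals all_analysis.
From mathcomp Require Import complex.

Set Implicit Arguments.
Unset Strict Implicit.
Unset Printing Implicit Defensive.

Import Order.TTheory GRing.Theory Num.Theory.
Import numFieldNormedType.Exports.

Local Open Scope classical_set_scope.
Local Open Scope ring_scope.
Local Open Scope complex_scope.

(* A Hierarchy-Builder structure joining rings and normed modules would need a
   missing join below [Num.NumDomain].  So the algebra structure is bundled by
   hand over a [completeNormedModType], and the alias [balg_sort] carries both
   the normed module and the ring instances.
   The zero algebra is not excluded, and [`|1| = 1] is not required: in a
   nonzero C*-algebra it follows from the C*-identity. *)
Record banachAlgType (R : realType) := BanachAlgType {
  balg_module : completeNormedModType R[i] ;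
  balg_one : balg_module ;
  balg_mul : balg_module -> balg_module -> balg_module ;
  balg_mulA : associative balg_mul ;
  balg_mul1r : left_id balg_one balg_mul ;
  balg_mulr1 : right_id balg_one balg_mul ;
  balg_mulDl : left_distributive balg_mul +%R ;
  balg_mulDr : right_distributive balg_mul +%R ;
  balg_scaleAl : forall (a : R[i]) x y,
    a *: balg_mul x y = balg_mul (a *: x) y ;
  balg_scaleAr : forall (a : R[i]) x y,
    a *: balg_mul x y = balg_mul x (a *: y) ;
  balg_normM : forall x y, `|balg_mul x y| <= `|x| * `|y|
}.

Definition balg_sort (R : realType) (B : banachAlgType R) : Type :=
  balg_module B.
Coercion balg_sort : banachAlgType >-> Sortclass.

HB.instance Definition _ (R : realType) (B : banachAlgType R) :=
  CompleteNormedModule.on (balg_sort B).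
HB.instance Definition _ (R : realType) (B : banachAlgType R) :=
  GRing.Zmodule_isPzRing.Build (balg_sort B)
    (@balg_mulA R B) (@balg_mul1r R B) (@balg_mulr1 R B)
    (@balg_mulDl R B) (@balg_mulDr R B).

Record cstarAlgType (R : realType) := CStarAlgType {
  cstar_banach :> banachAlgType R ;
  star : cstar_banach -> cstar_banach ;
  starD : {morph star : x y / x + y} ;
  starZ : forall (a : R[i]) (x : cstar_banach), star (a *: x) = a^* *: star x ;
  starM : forall x y : cstar_banach, star (x * y) = star y * star x ;
  starK : involutive star ;
  cstar_norm : forall x : cstar_banach, `|star x * x| = `|x| ^+ 2
}.
Arguments star {R c} x : rename.

Section CStarDefs.
Context {R : realType} {A : cstarAlgType R}.
Implicit Types (x y p : A) (alpha : A -> A).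

Definition commutator x y : A := x * y - y * x.

Definition is_projection p : Prop := star p = p /\ p * p = p.

Definition is_partial_isometry p : Prop := is_projection (star p * p).

Record is_automorphism alpha : Prop := IsAutomorphism {
  automorphism_linear : linear alpha ;
  automorphism_monoid : monoid_morphism alpha ;
  automorphism_star : {morph alpha : x / star x} ;
  automorphism_bij : bijective alpha
}.

(* [ordS] is the cyclic successor of ['I_n], hence the convention
   [e_{i, k_i} = e_{i, 0}]. *)
Definition rohlin_property alpha : Prop :=
  forall k : nat, (0 < k)%N ->
  exists (m : nat) (ks : 'I_m -> nat),
    [/\ (0 < m)%N,
        forall i, (0 < ks i)%N /\ (k <= ks i)%N &
        forall (F : set A) (eps : R), finite_set F -> 0 < eps ->
        exists e : forall i : 'I_m, 'I_(ks i) -> A,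
          [/\ forall i j, is_projection (e i j),
              \sum_(i < m) \sum_(j < ks i) e i j = 1,
              forall i j, `|alpha (e i j) - e i (ordS j)| < eps%:C &
              forall i j x, F x -> `|commutator x (e i j)| < eps%:C]].

End CStarDefs.

(* Main.v *)
Require Import Defs.
From HB Require Import structures.
From mathcomp Require Import all_boot all_order all_algebra.
From mathcomp Require Import all_classical all_reals all_analysis.
From mathcomp Require Import complex.
From mathcomp Require Import ring lra zify.

Set Implicit Arguments.
Unset Strict Implicit.
Unset Printing Implicit Defensive.

Import Order.TTheory GRing.Theory Num.Theory.
Import numFieldNormedType.Exports.

Local Open Scope classical_set_scope.
Local Open Scope ring_scope.
Local Open Scope complex_scope.

(** Write [f] for the source projection [star p * p].  The translates
    [alpha^i p], cut down to [f], are close to partial isometries with the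
    common source [f] and with the projections [e i] of the given tower as
    ranges.
    They are vectors of the Hilbert module [A * f], whose inner product
    [star x * y] takes values in [f * A * f], and together with [f] itself they
    are nearly orthonormal.  Gram-Schmidt makes them exactly orthonormal
    ([gram_schmidt], [exact_frames]): there are [y 0 = f], [y 1], ..., [y M]
    with [star (y i) * y j] equal to [f] or [0] and with range projections
    summing to [1], and [alpha] nearly fixes [y 0] and nearly maps [y i] to
    [y (i + 1)], except for [y M], over whose image nothing is known.  The
    elements [y i * star (y j)] are then matrix units of a unital matrix
    algebra, in which all further projections are computed exactly; estimates
    concern only [alpha] and commutators.

    Take [M = n * K] and average the vectors along residue classes modulo [K]:
    [w i] is [n^(-1/2)] times the sum of the [y j] with [j - 1] congruent to [i].
    The uncontrolled vector [alpha (y M)] is damped by [n^(-1/2)], so for large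
    [n] the [w i] are permuted cyclically by [alpha].  The range projections of
    the [y j] in one class add up to projections [E i], also permuted
    cyclically, because [alpha] preserves their total [1 - f]; hence so are the
    complements [D i = E i - w i * star (w i)], which form a tower of length [K]
    ([exists_cyclic_frame]).

    There remains the span of [f] and of [w 0], ..., [w (K - 1)], on which
    [alpha] acts as a unitary with eigenvalues the [K]-th roots of unity and one
    more [1], the latter on [f].  These [K + 1] numbers, in cyclic order, are
    within [2 * pi / (K + 1)] of the [(K + 1)]-st roots of unity
    ([roots_matching]).  So a diagonal perturbation of the identity of that size
    turns the action into one with spectrum all the [(K + 1)]-st roots, and the
    Fourier transform of an eigenbasis is an orthonormal basis moved cyclically
    by it: this gives a tower of length [K + 1] ([regular_tower]).  The
    perturbation is small in operator norm, so the error does not accumulate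
    when projections of this tower are added.

    Finally, for given [k], [K] is chosen large, divisible by [k] and with
    [K + 1] divisible by [k + 1].  Adding up every [k]-th projection of the
    first tower and every [(k + 1)]-st of the second gives towers of the fixed
    lengths [k] and [k + 1] ([two_towers]).

    Two analytic facts are built from a fixed point argument giving inverse
    square roots of elements near [1] ([inverse_sqrt]): polar decomposition of
    almost isometric elements, and boundedness of automorphisms.  Error terms
    are mostly handled by working with sequences modulo null sequences. *)

(** * The norm as a real number, and projections *)

Section RealNorm.
Context {R : realType} {A : cstarAlgType R}.
Implicit Types (x y z p q : A) (a b : R[i]) (r : R).

Lemma balgZl a x y : (a *: x) * y = a *: (x * y).
Proof. by rewrite /GRing.mul /= balg_scaleAl. Qed.

Lemma balgZr a x y : x * (a *: y) = a *: (x * y).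
Proof. by rewrite /GRing.mul /= balg_scaleAr. Qed.

Lemma star0 : star (0 : A) = 0.
Proof. by apply: (addrI (star 0)); rewrite -starD !addr0. Qed.

Lemma starN x : star (- x) = - star x.
Proof. by apply/eqP; rewrite -addr_eq0 -starD addNr star0. Qed.

Lemma starB x y : star (x - y) = star x - star y.
Proof. by rewrite starD starN. Qed.

Lemma star1 : star (1 : A) = 1.
Proof. by rewrite -[LHS]mulr1 -{2}(starK 1) -starM mulr1 starK. Qed.

Lemma star_sum (I : Type) (s : seq I) (P : pred I) (F : I -> A) :
  star (\sum_(i <- s | P i) F i) = \sum_(i <- s | P i) star (F i).
Proof. exact: (big_morph star (@starD R A) star0). Qed.

Lemma realCD r1 r2 : (r1 + r2)%:C = r1%:C + r2%:C :> R[i].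
Proof. exact: rmorphD. Qed.

Lemma realCM r1 r2 : (r1 * r2)%:C = r1%:C * r2%:C :> R[i].
Proof. exact: rmorphM. Qed.

(** The norm takes its values in [R[i]]; its real part is used so that
    estimates take place in an ordered field. *)
Definition nrm x : R := complex.Re `|x|.

Lemma nrmE x : `|x| = (nrm x)%:C.
Proof. by rewrite /nrm RRe_real// ger0_real. Qed.

Lemma nrm_ge0 x : 0 <= nrm x.
Proof. by rewrite -lecR -nrmE normr_ge0. Qed.

Lemma ltnrm x r : (`|x| < r%:C) = (nrm x < r).
Proof. by rewrite nrmE ltcR. Qed.

Lemma nrm0 : nrm 0 = 0.
Proof. by apply: complexI; rewrite -nrmE normr0. Qed.

Lemma nrm0_eq0 x : nrm x = 0 -> x = 0.
Proof. by move=> x0; apply/normr0_eq0; rewrite nrmE x0. Qed.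

Lemma nrmN x : nrm (- x) = nrm x.
Proof. by rewrite /nrm normrN. Qed.

Lemma nrm_distC x y : nrm (x - y) = nrm (y - x).
Proof. by rewrite -nrmN opprB. Qed.

Lemma nrmD x y : nrm (x + y) <= nrm x + nrm y.
Proof. by rewrite -lecR realCD -!nrmE ler_normD. Qed.

Lemma nrmB x y : nrm (x - y) <= nrm x + nrm y.
Proof. by rewrite -(nrmN y) nrmD. Qed.

Lemma nrm_dist_triangle y x z : nrm (x - z) <= nrm (x - y) + nrm (y - z).
Proof. by rewrite -[x - z](subrKA y) nrmD. Qed.

Lemma nrmM x y : nrm (x * y) <= nrm x * nrm y.
Proof. by rewrite -lecR realCM -!nrmE balg_normM. Qed.

Lemma nrmZ a x : nrm (a *: x) = Normc.normc a * nrm x.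
Proof. by apply: complexI; rewrite realCM -!nrmE normrZ. Qed.

Lemma nrm_cstar x : nrm (star x * x) = nrm x ^+ 2.
Proof. by apply: complexI; rewrite expr2 realCM -!nrmE cstar_norm. Qed.

Lemma nrm_star x : nrm (star x) = nrm x.
Proof.
suff le_star y : nrm y <= nrm (star y).
  by apply/eqP; rewrite eq_le le_star andbT -{2}[x]starK le_star.
have := nrm_cstar y; have := nrmM (star y) y.
have := nrm_ge0 y; have := nrm_ge0 (star y); nra.
Qed.

Lemma nrm_sum_le (n : nat) (F : nat -> A) r :
  (forall i, (i < n)%N -> nrm (F i) <= r) ->
  nrm (\sum_(i < n) F i) <= n%:R * r.
Proof.
elim: n => [|n IHn] leFr; first by rewrite big_ord0 nrm0 mul0r.
rewrite big_ord_recr /= (le_trans (nrmD _ _))// -natr1 mulrDl mul1r.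
by rewrite lerD ?leFr// IHn// => i ltin; apply/leFr/ltnW.
Qed.

Lemma nrm_projection p : is_projection p -> nrm p <= 1.
Proof.
move=> [sp pp]; have : nrm p = nrm p ^+ 2 by rewrite -nrm_cstar sp pp.
by have := nrm_ge0 p; nra.
Qed.

Lemma nrm_partial_isometry x : is_projection (star x * x) -> nrm x <= 1.
Proof.
by move=> /nrm_projection; rewrite nrm_cstar; have := nrm_ge0 x; nra.
Qed.

(** The norm of a projection solves [t = t ^+ 2], so it is [0] or [1]. *)
Lemma projection_eq0 p : is_projection p -> nrm p < 1 -> p = 0.
Proof.
move=> [sp pp] lt1; apply/nrm0_eq0.
have : nrm p = nrm p ^+ 2 by rewrite -nrm_cstar sp pp.
by have := nrm_ge0 p; nra.
Qed.

Lemma projectionC p : is_projection p -> is_projection (1 - p).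
Proof.
move=> [sp pp]; split; first by rewrite starB star1 sp.
by rewrite mulrBl !mulrBr !mul1r mulr1 pp subrr subr0.
Qed.

Lemma projectionB p q : is_projection p -> is_projection q -> p * q = q ->
  is_projection (p - q).
Proof.
move=> [sp pp] [sq qq] pq; have qp : q * p = q by rewrite -sq -sp -starM pq.
by split; rewrite ?starB ?sp ?sq// mulrBl !mulrBr pp pq qp qq subrr subr0.
Qed.

(** By the C*-identity, [p - p * f] vanishes for [f := star p * p], since
    [star (p - p * f) * (p - p * f)] does. *)
Lemma partial_isometryE p : is_partial_isometry p -> p * (star p * p) = p.
Proof.
rewrite /is_partial_isometry; move fE: (star p * p) => f [sf ff].
apply/subr0_eq/nrm0_eq0/eqP; rewrite -sqrf_eq0 -nrm_cstar.
rewrite starB starM sf mulrBl !mulrBr -!mulrA.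
by rewrite [star p * (p * _)]mulrA !fE !ff !subrr nrm0.
Qed.

End RealNorm.

(** * Inverse square roots by a fixed point argument *)

Section FixedPoint.
Context {R : realType} {A : cstarAlgType R}.
Implicit Types (x y z d k l : A) (r e : R).

Lemma nrmZr r x : nrm (r%:C *: x) = `|r| * nrm x.
Proof.
apply: complexI; rewrite realCM -!nrmE normrZ normc_def /= expr0n addr0.
by rewrite sqrtr_sqr.
Qed.

Lemma nrm_1 : nrm (1 : A) <= 1.
Proof. by apply: nrm_projection; split; rewrite ?star1 ?mulr1. Qed.

Lemma geometric_lt r e : 0 < e -> exists n, r * 2^-1 ^+ n < e.
Proof.
move=> e0; have /cvgrPdist_lt /(_ _ e0) [n _ /(_ n)] :=
  @cvg_geometric R r 2^-1 ltac:(rewrite gtr0_norm; lra).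
rewrite /= sub0r normrN => /(_ (leqnn _)) hn.
by exists n; apply: le_lt_trans hn; rewrite ler_norm.
Qed.

Lemma geometric_cvg (u : nat -> A) r :
  (forall n m, (n <= m)%N -> nrm (u m - u n) <= r * 2^-1 ^+ n) ->
  exists l, forall n, nrm (u n - l) <= r * 2^-1 ^+ n.
Proof.
move=> hu.
have /cauchy_cvgP/cvg_ex [l ul] : cauchy (u @ \oo).
  apply: cauchy_exP => e e0.
  have /(geometric_lt r) [n ltn] : 0 < complex.Re e.
    by move: e0; rewrite ltcE => /andP[].
  exists (u n); exists n => // m /= lenm.
  have eE : e = (complex.Re e)%:C by rewrite RRe_real// gtr0_real.
  rewrite -ball_normE /= eE -[u n - u m]/((u n : A) - (u m : A)) ltnrm nrm_distC.
  exact: le_lt_trans (hu _ _ lenm) ltn.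
exists l => n; apply/ler_addgt0Pl => e e0.
have /cvgrPdist_lt /(_ e%:C) := ul.
rewrite ltcR e0 => /(_ isT) [m _ /(_ (maxn m n) (leq_maxl _ _))] /=.
rewrite -[l - u (maxn m n)]/((l : A) - (u (maxn m n) : A)) ltnrm => /ltW hl.
rewrite (le_trans (nrm_dist_triangle (u (maxn m n)) _ _))// addrC lerD//.
  by rewrite nrm_distC.
by rewrite nrm_distC hu// leq_maxr.
Qed.

(** Banach's fixed point theorem.  Closedness of [S] is spelled out in terms of
    [nrm], the form in which it is checked for algebraic conditions. *)
Lemma contraction_fixed_point (S : A -> Prop) (T : A -> A) x0 : S x0 ->
  (forall x, S x -> S (T x)) ->
  (forall x y, S x -> S y -> nrm (T x - T y) <= 2^-1 * nrm (x - y)) ->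
  (forall l, (forall e, 0 < e -> exists2 x, S x & nrm (x - l) < e) -> S l) ->
  exists2 l, S l & T l = l.
Proof.
move=> Sx0 ST lipT clS; pose u n := iter n T x0.
have Su n : S (u n) by elim: n => //= n; apply: ST.
pose r := 2 * nrm (u 1%N - u 0%N).
have r0 : 0 <= r by rewrite mulr_ge0// nrm_ge0.
have step n : nrm (u n.+1 - u n) <= r / 2 * 2^-1 ^+ n.
  elim: n => [|n IHn]; first by rewrite expr0 mulr1 /r; lra.
  rewrite exprS mulrCA; apply: le_trans (lipT _ _ (Su n.+1) (Su n)) _.
  by rewrite ler_wpM2l.
have hu n j : nrm (u (n + j)%N - u n) <= r * (2^-1 ^+ n - 2^-1 ^+ (n + j)).
  elim: j => [|j IHj]; first by rewrite addn0 !subrr nrm0 mulr0.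
  rewrite addnS (le_trans (nrm_dist_triangle (u (n + j)%N) _ _))//.
  have := step (n + j)%N; rewrite [_ ^+ (n + j).+1]exprS => st.
  by rewrite /= in st *; lra.
have [l ul] : exists l, forall n, nrm (u n - l) <= r * 2^-1 ^+ n.
  apply: geometric_cvg => n m /subnKC <-; apply: le_trans (hu _ _) _.
  by rewrite ler_wpM2l// gerBl exprn_ge0.
have Sl : S l.
  apply: clS => e /(geometric_lt r) [n ltn].
  by exists (u n) => //; apply: le_lt_trans ltn.
exists l => //; apply/subr0_eq/nrm0_eq0/eqP; rewrite eq_le nrm_ge0 andbT.
apply/ler_addgt0Pl => e e0; rewrite addr0.
have [n ltn] := geometric_lt r e0.
rewrite (le_trans (nrm_dist_triangle (u n.+1) _ _))//.
have := lipT _ _ Sl (Su n); rewrite (nrm_distC l) /=.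
by have := ul n; have := ul n.+1; rewrite exprS /=; lra.
Qed.

Lemma half_double x : (2^-1)%:C *: x + (2^-1)%:C *: x = x.
Proof.
rewrite -scalerDl -realCD (_ : 2^-1 + 2^-1 = 1 :> R) ?scale1r//; lra.
Qed.

Lemma starZc (a : R[i]) x : star (a *: x) = conjc a *: star x.
Proof. exact: starZ. Qed.

Lemma starZr r x : star (r%:C *: x) = r%:C *: star x.
Proof. by rewrite starZc conjc_real. Qed.

(** The element [1 + k] is [(1 - d)^(-1/2)]; it is found as a fixed point of
    the map [k |-> (d * (1 + k) ^ 2 - k ^ 2) / 2], which contracts the ball of
    radius [1/4].  Commutation with whatever commutes with [d] is a closed
    condition preserved by this map; it says that [1 + k] is a function of
    [d]. *)
Lemma inverse_sqrt d : star d = d -> nrm d <= 16^-1 ->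
  exists k, [/\ star k = k, nrm k <= 2 * nrm d,
                forall y, y * d = d * y -> y * k = k * y &
                (1 + k) * (1 + k) * (1 - d) = 1].
Proof.
move=> sd d16; have d0 := nrm_ge0 d; have n1 := nrm_1.
pose S k := [/\ star k = k, nrm k <= 2 * nrm d &
                forall y, y * d = d * y -> y * k = k * y].
pose T k := (2^-1)%:C *: (d * ((1 + k) * (1 + k)) - k * k).
have n1k k : S k -> nrm (1 + k) <= 5 / 4.
  by move=> [_ kd _]; have := nrmD 1 k; lra.
have commT k y : y * k = k * y -> y * (1 + k) = (1 + k) * y.
  by move=> yk; rewrite mulrDr mulrDl mulr1 mul1r yk.
have [|k Sk|x y Sx Sy|l Sl|k [sk kd ck] Tk] := @contraction_fixed_point S T 0.
- by split; rewrite ?star0 ?nrm0 ?mulr_ge0// => y _; rewrite mul0r mulr0.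
- have c54 := n1k _ Sk; have [sk kd ck] := Sk.
  have cd : d * (1 + k) = (1 + k) * d by exact/commT/ck.
  split.
  + rewrite starZr starB !starM starD star1 sk sd; congr (_ *: (_ - _)).
    by rewrite -mulrA -cd !mulrA cd.
  + rewrite nrmZr gtr0_norm ?invr_gt0//.
    have h1 := nrmB (d * ((1 + k) * (1 + k))) (k * k).
    have h2 := nrmM d ((1 + k) * (1 + k)); have h3 := nrmM (1 + k) (1 + k).
    have h4 := nrmM k k.
    have k0 := nrm_ge0 k; have c0 := nrm_ge0 (1 + k).
    have h5 : nrm ((1 + k) * (1 + k)) <= 25 / 16 by nra.
    have h6 : nrm k * nrm k <= 4^-1 * (2 * nrm d) by nra.
    have h7 : nrm d * nrm ((1 + k) * (1 + k)) <= nrm d * (25 / 16) by nra.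
    lra.
  + move=> y yd; have yk := ck _ yd; rewrite /T balgZr balgZl; congr (_ *: _).
    have yc := commT _ _ yk.
    rewrite mulrBr mulrBl; congr (_ - _).
      by rewrite [LHS]mulrA yd -!mulrA [y * (_ * _)]mulrA yc -mulrA yc.
    by rewrite [LHS]mulrA yk -!mulrA yk.
- have cx := n1k _ Sx; have cy := n1k _ Sy.
  have [_ xd _] := Sx; have [_ yd _] := Sy.
  rewrite /T -scalerBr nrmZr gtr0_norm ?invr_gt0// ler_pM2l ?invr_gt0//.
  have -> : d * ((1 + x) * (1 + x)) - x * x - (d * ((1 + y) * (1 + y)) - y * y)
    = d * ((1 + x) * (x - y) + (x - y) * (1 + y)) - (x * (x - y) + (x - y) * y).
    have sq (a b : A) : a * a - b * b = a * (a - b) + (a - b) * b.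
      by rewrite mulrBr mulrBl addrA subrK.
    rewrite -(sq x y) (_ : x - y = (1 + x) - (1 + y)).
      by rewrite -(sq (1 + x) (1 + y)) mulrBr !opprD !opprK [LHS]addrACA.
    by rewrite opprD addrACA subrr add0r.
  have h1 := nrmB (d * ((1 + x) * (x - y) + (x - y) * (1 + y)))
                  (x * (x - y) + (x - y) * y).
  have h2 := nrmM d ((1 + x) * (x - y) + (x - y) * (1 + y)).
  have h3 := nrmD ((1 + x) * (x - y)) ((x - y) * (1 + y)).
  have h4 := nrmD (x * (x - y)) ((x - y) * y).
  have h5 := nrmM (1 + x) (x - y); have h6 := nrmM (x - y) (1 + y).
  have h7 := nrmM x (x - y); have h8 := nrmM (x - y) y.
  have e0 := nrm_ge0 (x - y); set e := nrm (x - y) in e0 h5 h6 h7 h8 *.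
  have h9 : nrm ((1 + x) * (x - y) + (x - y) * (1 + y)) <= 5 / 2 * e by nra.
  have h10 : nrm (x * (x - y) + (x - y) * y) <= e / 4 by nra.
  have := nrm_ge0 ((1 + x) * (x - y) + (x - y) * (1 + y)).
  by nra.
- have lim_eq0 z C : (forall x e, S x -> nrm (x - l) <= e -> nrm z <= C * e) ->
      z = 0.
    move=> hz; apply/nrm0_eq0/eqP; rewrite eq_le nrm_ge0 andbT.
    have C0 : 0 <= C.
      have [x Sx xl] := Sl 1 ltr01.
      by have := hz _ _ Sx (ltW xl); have := nrm_ge0 z; lra.
    apply/ler_addgt0Pl => e e0; rewrite addr0.
    have [|x Sx xl] := Sl (e / (C + 1)); first by rewrite divr_gt0//; lra.
    rewrite (le_trans (hz _ _ Sx (ltW xl)))// mulrCA ger_pMr//.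
    by rewrite ler_pdivrMr; lra.
  have l0 := nrm_ge0 l.
  split.
  + apply/subr0_eq/(lim_eq0 _ 2) => x e [sx _ _] xl.
    rewrite (_ : star l - l = star (l - x) + (x - l)).
      by rewrite (le_trans (nrmD _ _))// nrm_star (nrm_distC l x); lra.
    by rewrite starB sx subrKA.
  + apply/ler_addgt0Pl => e /Sl [x [_ xd _] xl].
    have lE : l - x + x = l by exact: subrK.
    by have := nrmD (l - x) x; rewrite lE (nrm_distC l x); lra.
  + move=> y yd; apply/subr0_eq/(lim_eq0 _ (2 * nrm y)) => x e [_ _ cx] xl.
    have -> : y * l - l * y = (x - l) * y - y * (x - l).
      by rewrite mulrBl mulrBr (cx _ yd) opprB [RHS]addrC subrKA.
    have := nrmB ((x - l) * y) (y * (x - l)).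
    have := nrmM (x - l) y; have := nrmM y (x - l); have := nrm_ge0 y.
    nra.
- exists k; split => //.
  have kk : k + k = d * ((1 + k) * (1 + k)) - k * k.
    by rewrite -{1 2}Tk half_double.
  have -> : (1 + k) * (1 + k) * (1 - d) = (1 - d) * ((1 + k) * (1 + k)).
    have cd : d * (1 + k) = (1 + k) * d by exact/commT/ck.
    by rewrite mulrBr mulrBl mulr1 mul1r -[_ * d]mulrA -cd !mulrA cd.
  apply/eqP; rewrite mulrBl mul1r subr_eq; apply/eqP.
  rewrite {1}mulrDr mulr1 mulrDl mul1r -!addrA; congr (_ + _).
  by rewrite addrA kk subrK.
Qed.

End FixedPoint.

(** * Boundedness of automorphisms *)

Section Automorphisms.
Context {R : realType} {A : cstarAlgType R}.
Implicit Types (x y h u d k : A) (alpha : A -> A).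

Section Morphism.
Variable alpha : A -> A.
Hypothesis halpha : is_automorphism alpha.

Lemma autD x y : alpha (x + y) = alpha x + alpha y.
Proof. by have := automorphism_linear halpha 1 x y; rewrite !scale1r. Qed.

Lemma aut0 : alpha 0 = 0.
Proof. by apply: (addrI (alpha 0)); rewrite -autD !addr0. Qed.

Lemma autZ (a : R[i]) x : alpha (a *: x) = a *: alpha x.
Proof. by have := automorphism_linear halpha a x 0; rewrite !addr0 aut0 addr0. Qed.

Lemma autN x : alpha (- x) = - alpha x.
Proof. by apply/eqP; rewrite -addr_eq0 -autD addNr aut0. Qed.

Lemma autB x y : alpha (x - y) = alpha x - alpha y.
Proof. by rewrite autD autN. Qed.

Lemma autM x y : alpha (x * y) = alpha x * alpha y.
Proof. by case: (automorphism_monoid halpha). Qed.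

Lemma aut1 : alpha 1 = 1.
Proof. by case: (automorphism_monoid halpha). Qed.

Lemma aut_star x : alpha (star x) = star (alpha x).
Proof. exact: automorphism_star. Qed.

Lemma aut_sum (I : Type) (s : seq I) (P : pred I) (F : I -> A) :
  alpha (\sum_(i <- s | P i) F i) = \sum_(i <- s | P i) alpha (F i).
Proof. exact: (big_morph alpha autD aut0). Qed.

Lemma aut_projection p : is_projection p -> is_projection (alpha p).
Proof. by move=> [sp pp]; split; rewrite -?aut_star -?autM ?sp ?pp. Qed.

End Morphism.

Lemma automorphism_iter alpha i :
  is_automorphism alpha -> is_automorphism (iter i alpha).
Proof.
move=> ha; elim: i => [|i hi]; first by split => //; exists id.
split => [a x y|||] /=.
- by rewrite (automorphism_linear hi) (automorphism_linear ha).
- by split => [|x y] /=; rewrite ?(aut1 hi) ?(aut1 ha)// (autM hi) (autM ha).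
- by move=> x /=; rewrite (aut_star hi) (aut_star ha).
- exact: bij_comp (automorphism_bij ha) (automorphism_bij hi).
Qed.

Lemma nrm_isometry u : star u * u = 1 -> nrm u <= 1.
Proof.
move=> uu; apply: nrm_partial_isometry; rewrite uu.
by split; rewrite ?star1 ?mulr1.
Qed.

(** A small self-adjoint [h] is the real part of the unitary
    [h + i (1 - h ^ 2)^(1/2)], where the square root is
    [(1 - h ^ 2)^(-1/2) * (1 - h ^ 2)]. *)
Lemma selfadjoint_unitary h : star h = h -> nrm h <= 4^-1 ->
  exists2 u, star u * u = 1 & h + h = u + star u.
Proof.
move=> sh h4.
have h16 : nrm (h * h) <= 16^-1.
  by have := nrmM h h; have := nrm_ge0 h; nra.
have sd : star (h * h) = h * h by rewrite starM sh.
have [k [sk _ ck hk]] := inverse_sqrt sd h16.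
have kh : h * k = k * h by apply: ck; rewrite mulrA.
set d := h * h in sd ck hk.
have kd : d * k = k * d by exact: ck.
have hd : h * d = d * h by rewrite /d mulrA.
have c1 (x y : A) : x * y = y * x -> x * (1 + y) = (1 + y) * x.
  by move=> xy; rewrite mulrDr mulrDl mulr1 mul1r xy.
have c2 (x y : A) : x * y = y * x -> x * (1 - y) = (1 - y) * x.
  by move=> xy; apply: c1; rewrite mulrN mulNr xy.
pose s := (1 + k) * (1 - d).
have hs : h * s = s * h.
  by rewrite /s mulrA (c1 _ _ kh) -!mulrA (c2 _ _ hd).
have dk : (1 - d) * (1 + k) = (1 + k) * (1 - d) by apply/c1/esym/c2.
have ss : star s = s.
  by rewrite /s starM starB starD star1 sk sd dk.
have s2 : s * s = 1 - d.
  by rewrite /s -mulrA [(1 - d) * _]mulrA dk !mulrA hk mul1r.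
pose i : R[i] := 0 +i* 1.
have si : star (i *: s) = - (i *: s).
  by rewrite starZc ss -scaleNr; congr (_ *: _); rewrite /i; simpc.
exists (h + i *: s).
  rewrite starD sh si mulrBl !mulrDr balgZl !balgZr balgZl scalerA hs s2.
  rewrite (_ : i * i = -1); last by rewrite /i; simpc.
  by rewrite scaleN1r opprD opprK addrA addrK -/d addrC subrK.
by rewrite starD sh si addrACA subrr addr0.
Qed.

(** Unitaries go to unitaries, which have norm at most [1]; this bounds
    [alpha] on small self-adjoint elements, hence on all of them by scaling,
    and then everywhere by the C*-identity. *)
Lemma nrm_aut alpha x : is_automorphism alpha -> nrm (alpha x) <= 2 * nrm x.
Proof.
move=> ha.
have small h : star h = h -> nrm h <= 4^-1 -> nrm (alpha h) <= 1.
  move=> sh h4; have [u uu hu] := selfadjoint_unitary sh h4.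
  have au : nrm (alpha u) <= 1.
    by apply: nrm_isometry; rewrite -(aut_star ha) -(autM ha) uu (aut1 ha).
  have -> : alpha h = (2^-1)%:C *: (alpha u + star (alpha u)).
    rewrite -(aut_star ha) -(autD ha) -hu (autD ha) scalerDr.
    by rewrite -scalerDl -realCD (_ : 2^-1 + 2^-1 = 1 :> R) ?scale1r//; lra.
  rewrite nrmZr gtr0_norm ?invr_gt0//.
  by have := nrmD (alpha u) (star (alpha u)); rewrite nrm_star; lra.
have sabound h : star h = h -> nrm (alpha h) <= 4 * nrm h.
  move=> sh; have := nrm_ge0 h; rewrite le_eqVlt => /predU1P[h0|h0].
    by rewrite (nrm0_eq0 (esym h0)) (aut0 ha) nrm0 mulr0.
  pose r := (4 * nrm h)^-1; have r0 : 0 < r by rewrite invr_gt0 mulr_gt0.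
  have := small (r%:C *: h).
  rewrite starZr sh => /(_ erefl).
  rewrite (autZ ha) !nrmZr gtr0_norm// /r invfM -mulrA mulVf ?gt_eqF// mulr1.
  move=> /(_ (lexx _)); rewrite -invfM mulrC ler_pdivrMr ?mul1r//.
  by rewrite mulr_gt0.
have := sabound (star x * x); rewrite starM starK => /(_ erefl).
rewrite (autM ha) (aut_star ha) !nrm_cstar.
by have := nrm_ge0 x; have := nrm_ge0 (alpha x); nra.
Qed.

End Automorphisms.

(** * Sequences modulo null sequences *)

Section NullSequences.
Context {R : realType} {A : cstarAlgType R}.
Implicit Types (x y z u v : nat -> A) (e C : R).

(** Congruence modulo null sequences.  On bounded sequences it is a congruence
    for all the operations, so that in effect one computes in the quotient of
    bounded sequences by null sequences, where relations hold exactly. *)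
Definition approx x y : Prop :=
  forall e, 0 < e -> \forall s \near \oo, nrm (x s - y s) < e.

Definition bounded_seq x : Prop :=
  exists C, \forall s \near \oo, nrm (x s) <= C.

Lemma approx_eq x y : (\forall s \near \oo, x s = y s) -> approx x y.
Proof.
by move=> xy e e0; apply: filterS xy => s ->; rewrite subrr nrm0.
Qed.

Lemma approx_eqW x y : (forall s, x s = y s) -> approx x y.
Proof. by move=> xy; apply: approx_eq; apply: nearW. Qed.

Lemma approx_refl x : approx x x.
Proof. exact: approx_eqW. Qed.

Lemma approx_sym x y : approx x y -> approx y x.
Proof. by move=> xy e /xy; apply: filterS => s; rewrite nrm_distC. Qed.

Lemma approx_trans y x z : approx x y -> approx y z -> approx x z.
Proof.
move=> xy yz e e0; have e2 : 0 < e / 2 by lra.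
apply: filterS2 (xy _ e2) (yz _ e2) => s hxy hyz.
by have := nrm_dist_triangle (y s) (x s) (z s); lra.
Qed.

(** Compatibility of [approx] with an operation reduces to a Lipschitz bound
    for that operation. *)
Lemma approx_le x y u v C : approx u v ->
  (\forall s \near \oo, nrm (x s - y s) <= C * nrm (u s - v s)) -> approx x y.
Proof.
move=> uv hC e e0; pose K := `|C| + 1.
have K0 : 0 < K by rewrite ltr_wpDl.
apply: filterS2 hC (uv (e / K) _) => [s h1 h2|]; last by rewrite divr_gt0.
apply: le_lt_trans h1 _; move: h2; rewrite ltr_pdivlMr// => h2.
apply: le_lt_trans h2; rewrite mulrC ler_wpM2l ?nrm_ge0//.
by rewrite /K; have := ler_norm C; lra.
Qed.

Lemma approxN x y : approx x y -> approx (fun s => - x s) (fun s => - y s).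
Proof.
move=> xy; apply: (@approx_le _ _ x y 1) => //; apply: nearW => s.
by rewrite mul1r -opprD nrmN.
Qed.

Lemma approxD x y u v : approx x y -> approx u v ->
  approx (fun s => x s + u s) (fun s => y s + v s).
Proof.
move=> xy uv e e0; have e2 : 0 < e / 2 by lra.
apply: filterS2 (xy _ e2) (uv _ e2) => s hxy huv.
rewrite opprD addrACA.
by have := nrmD (x s - y s) (u s - v s); lra.
Qed.

Lemma approxB x y u v : approx x y -> approx u v ->
  approx (fun s => x s - u s) (fun s => y s - v s).
Proof. by move=> xy /approxN; apply: approxD. Qed.

Lemma approx_sum n (F G : nat -> nat -> A) :
  (forall i, (i < n)%N -> approx (F i) (G i)) ->
  approx (fun s => \sum_(i < n) F i s) (fun s => \sum_(i < n) G i s).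
Proof.
elim: n => [|n IHn] FG.
  by apply: approx_eqW => s; rewrite !big_ord0.
apply: (@approx_trans (fun s => \sum_(i < n) F i s + F n s)).
  by apply: approx_eqW => s; rewrite big_ord_recr.
apply: (@approx_trans (fun s => \sum_(i < n) G i s + G n s)).
  by apply: approxD; [apply: IHn => i /ltnW /FG|exact: FG].
by apply: approx_eqW => s; rewrite big_ord_recr.
Qed.

Lemma approxZ (a : R[i]) x y : approx x y ->
  approx (fun s => a *: x s) (fun s => a *: y s).
Proof.
move=> xy; apply: (@approx_le _ _ x y (Normc.normc a)) => //.
by apply: nearW => s; rewrite -scalerBr nrmZ.
Qed.

Lemma approx_star x y : approx x y ->
  approx (fun s => star (x s)) (fun s => star (y s)).
Proof.
move=> xy; apply: (@approx_le _ _ x y 1) => //.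
by apply: nearW => s; rewrite -starB nrm_star mul1r.
Qed.

Lemma approx_aut alpha x y : is_automorphism alpha -> approx x y ->
  approx (fun s => alpha (x s)) (fun s => alpha (y s)).
Proof.
move=> ha xy; apply: (@approx_le _ _ x y 2) => //.
by apply: nearW => s; rewrite -(autB ha) nrm_aut.
Qed.

Lemma bounded_cst (a : A) : bounded_seq (fun=> a).
Proof. by exists (nrm a); apply: nearW. Qed.

Lemma bounded_approx x y : approx x y -> bounded_seq y -> bounded_seq x.
Proof.
move=> xy [C yC]; exists (C + 1).
apply: filterS2 (xy 1 ltr01) yC => s h1 h2.
by have := nrmD (x s - y s) (y s); rewrite subrK; lra.
Qed.

Lemma bounded_star x : bounded_seq x -> bounded_seq (fun s => star (x s)).
Proof. by move=> [C xC]; exists C; apply: filterS xC => s; rewrite nrm_star. Qed.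

Lemma bounded_aut alpha x : is_automorphism alpha ->
  bounded_seq x -> bounded_seq (fun s => alpha (x s)).
Proof.
move=> ha [C xC]; exists (2 * C); apply: filterS xC => s h.
by have := nrm_aut (x s) ha; lra.
Qed.

Lemma boundedM x y : bounded_seq x -> bounded_seq y ->
  bounded_seq (fun s => x s * y s).
Proof.
move=> [C xC] [D yD]; exists (C * D); apply: filterS2 xC yD => s h1 h2.
by rewrite (le_trans (nrmM _ _))// ler_pM// nrm_ge0.
Qed.

Lemma approxMl x y u : bounded_seq u -> approx x y ->
  approx (fun s => u s * x s) (fun s => u s * y s).
Proof.
move=> [C uC] xy; apply: (@approx_le _ _ x y C) => //.
apply: filterS uC => s h; rewrite -mulrBr (le_trans (nrmM _ _))//.
by rewrite ler_wpM2r ?nrm_ge0.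
Qed.

Lemma approxMr x y u : bounded_seq u -> approx x y ->
  approx (fun s => x s * u s) (fun s => y s * u s).
Proof.
move=> [C uC] xy; apply: (@approx_le _ _ x y C) => //.
apply: filterS uC => s h; rewrite -mulrBl (le_trans (nrmM _ _))//.
by rewrite mulrC ler_wpM2r ?nrm_ge0.
Qed.

Lemma approxM x y u v : bounded_seq x -> bounded_seq v ->
  approx x y -> approx u v ->
  approx (fun s => x s * u s) (fun s => y s * v s).
Proof.
move=> bx bv xy uv; apply: (@approx_trans (fun s => x s * v s)).
  exact: approxMl.
exact: approxMr.
Qed.

Lemma approx_commM (c : A) u v : bounded_seq u -> bounded_seq v ->
  approx (fun s => c * u s) (fun s => u s * c) ->
  approx (fun s => c * v s) (fun s => v s * c) ->
  approx (fun s => c * (u s * v s)) (fun s => u s * v s * c).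
Proof.
move=> bu bv cu cv; apply: (@approx_trans (fun s => u s * (c * v s))).
  apply: (@approx_trans (fun s => c * u s * v s)).
    by apply: approx_eqW => s; rewrite mulrA.
  apply: (@approx_trans (fun s => u s * c * v s)); first exact: approxMr.
  by apply: approx_eqW => s; rewrite mulrA.
apply: (@approx_trans (fun s => u s * (v s * c))); first exact: approxMl.
by apply: approx_eqW => s; rewrite mulrA.
Qed.

Lemma near_forall_lt N (P : nat -> nat -> Prop) :
  (forall i, (i < N)%N -> \forall s \near \oo, P i s) ->
  \forall s \near \oo, forall i, (i < N)%N -> P i s.
Proof.
elim: N => [|N IHN] hP; first by apply: nearW.
apply: filterS2 (IHN _) (hP N _) => // [s h1 h2 i|i iN].
  by rewrite ltnS leq_eqVlt => /predU1P[->//|/h1].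
by apply: hP; rewrite ltnW.
Qed.

Lemma near_forall_finite (F : set A) (P : A -> nat -> Prop) : finite_set F ->
  (forall b, F b -> \forall s \near \oo, P b s) ->
  \forall s \near \oo, forall b, F b -> P b s.
Proof.
move=> /finite_seqP [bs ->] hP.
have := @near_forall_lt (size bs) (fun i => P (nth 0 bs i)).
have h i : (i < size bs)%N -> \forall s \near \oo, P (nth 0 bs i) s.
  by move=> ibs; apply: hP => /=; exact: mem_nth.
move=> /(_ h); apply: filterS => s hs b /= /(nthP 0) [i ibs <-].
exact: hs.
Qed.

Lemma approx_inv (x y : nat -> A) :
  (forall s, nrm (x s - y s) < s.+1%:R^-1) -> approx x y.
Proof.
move=> xy e e0; near=> s; apply: lt_trans (xy s) _.
by near: s; exact: near_infty_natSinv_lt (PosNum e0).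
Unshelve. all: by end_near. Qed.

End NullSequences.

(** * Orthonormal families in a Hilbert module *)

Section Frames.
Context {R : realType} {A : cstarAlgType R}.
Implicit Types (f v z : A) (y : nat -> A).

(** Orthonormality for the inner product [star x * y] of the Hilbert module
    [A * f]; only the first [N] vectors matter, so that frames can be extended
    without change of type. *)
Definition frame f N y : Prop := forall i j, (i < N)%N -> (j < N)%N ->
  star (y i) * y j = if i == j then f else 0.

Lemma frame_absorb f N y i : is_projection f -> frame f N y -> (i < N)%N ->
  y i * f = y i.
Proof.
move=> pf fr iN; rewrite -[in LHS](_ : star (y i) * y i = f).
  by apply: partial_isometryE; rewrite /is_partial_isometry fr// eqxx.
by rewrite fr// eqxx.
Qed.

Lemma frame_nrm f N y i : is_projection f -> frame f N y -> (i < N)%N ->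
  nrm (y i) <= 1.
Proof.
by move=> pf fr iN; apply: nrm_partial_isometry; rewrite fr// eqxx.
Qed.

Lemma frame_sum_absorb f N y j : is_projection f -> frame f N y -> (j < N)%N ->
  (\sum_(i < N) y i * star (y i)) * y j = y j.
Proof.
move=> pf fr jN; rewrite mulr_suml (bigD1 (Ordinal jN))//= big1 ?addr0 => [|i ij].
  by rewrite -mulrA fr// eqxx (frame_absorb pf fr).
rewrite -mulrA fr// ifF ?mulr0//; apply: contra_neqF ij => /eqP ij.
exact/val_inj.
Qed.

Lemma frame_sum_projection f N y : is_projection f -> frame f N y ->
  is_projection (\sum_(i < N) y i * star (y i)).
Proof.
move=> pf fr; split.
  by rewrite star_sum; apply: eq_bigr => i _; rewrite starM starK.
rewrite mulr_sumr; apply: eq_bigr => i _.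
by rewrite mulrA (frame_sum_absorb pf fr).
Qed.

(** Polar decomposition: [w] is [z * (star z * z)^(-1/2)], the inverse square
    root being taken in the corner [f * A * f].  Being a right multiple of [z],
    it stays orthogonal to whatever is orthogonal to [z]. *)
Lemma normalize f z : is_projection f -> z * f = z ->
  nrm (f - star z * z) <= 16^-1 ->
  exists w : A, [/\ star w * w = f, nrm (w - z) <= 2 * nrm z * nrm (f - star z * z)
             & forall v, v * z = 0 -> v * w = 0].
Proof.
move=> [sf ff] zf d16.
have fz : f * star z = star z by rewrite -sf -starM zf.
have fzz : f * (star z * z) = star z * z by rewrite mulrA fz.
have zzf : (star z * z) * f = star z * z by rewrite -mulrA zf.
move dE : (f - star z * z) d16 => d d16.
have zzE : star z * z = f - d by rewrite -dE opprB addrC subrK.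
have fd : f * d = d by rewrite -dE mulrBr ff fzz.
have df : d * f = d by rewrite -dE mulrBl ff zzf.
have sd : star d = d by rewrite -dE starB sf starM starK.
have [k [sk kd ck hk]] := inverse_sqrt sd d16.
have fk : f * k = k * f by apply: ck; rewrite fd df.
have dk : d * k = k * d by exact: ck.
exists (z * (1 + k)); split.
- have -> : star (z * (1 + k)) * (z * (1 + k)) =
      (1 + k) * ((star z * z) * (1 + k)).
    by rewrite starM starD star1 sk !mulrA.
  have -> : star z * z = f * (1 - d) by rewrite zzE mulrBr mulr1 fd.
  have cdk : (1 - d) * (1 + k) = (1 + k) * (1 - d).
    by rewrite mulrBl mulrBr mul1r !mulr1 mulrDr mulrDl mulr1 mul1r dk.
  have cfk : (1 + k) * f = f * (1 + k) by rewrite mulrDl mulrDr mul1r mulr1 fk.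
  by rewrite -mulrA cdk !mulrA cfk -!mulrA [(1 + k) * _]mulrA hk mulr1.
- rewrite mulrDr mulr1 addrAC subrr add0r (le_trans (nrmM _ _))//.
  by have := nrm_ge0 z; nra.
- by move=> v vz; rewrite mulrA vz mul0r.
Qed.

Lemma bounded_isometry (f x : nat -> A) : (forall s, is_projection (f s)) ->
  approx (fun s => star (x s) * x s) f -> bounded_seq x.
Proof.
move=> pf xf; exists 2; apply: filterS (xf 1 ltr01) => s h.
have := nrmD (star (x s) * x s - f s) (f s); rewrite subrK nrm_cstar.
by have := nrm_projection (pf s); have := nrm_ge0 (x s); nra.
Qed.

(** Gram-Schmidt in the Hilbert module [A * f]: the defect of orthonormality
    of each vector, once projected off the previous ones, is removed by
    [normalize].  The first vector is [f] itself and is left untouched. *)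
Lemma gram_schmidt N (f : nat -> A) (x : nat -> nat -> A) :
  (forall s, is_projection (f s)) -> x 0%N = f ->
  (forall i s, (i < N.+1)%N -> x i s * f s = x i s) ->
  (forall i j, (i < N.+1)%N -> (j < N.+1)%N ->
    approx (fun s => star (x i s) * x j s) (fun s => if i == j then f s else 0)) ->
  exists y : nat -> nat -> A, [/\ y 0%N = f,
    forall i, (i < N.+1)%N -> approx (y i) (x i) &
    \forall s \near \oo, frame (f s) N.+1 (y^~ s)].
Proof.
move=> pf x0; elim: N => [|N IHN] xf xx.
  exists x; split=> // [i _|]; first exact: approx_refl.
  apply: nearW => s [|//] [|//] _ _; rewrite eqxx /= x0.
  by have [-> ->] := pf s.
have [||y [y0 yx yfr]] := IHN.
- by move=> i s /ltnW; apply: xf.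
- by move=> i j /ltnW iN /ltnW jN; apply: xx.
have bx i : (i < N.+2)%N -> bounded_seq (x i).
  move=> iN; apply: (bounded_isometry pf).
  by have := xx _ _ iN iN; rewrite eqxx.
set n := N.+1 in IHN xf xx bx yx yfr *.
pose z s := x n s - \sum_(i < n) y i s * (star (y i s) * x n s).
have zf s : z s * f s = z s.
  rewrite /z mulrBl xf// mulr_suml; congr (_ - _); apply: eq_bigr => i _.
  by rewrite -!mulrA xf.
have yz : \forall s \near \oo, forall i, (i < n)%N -> star (y i s) * z s = 0.
  apply: filterS yfr => s fr i iN; rewrite /z mulrBr mulr_sumr.
  rewrite (bigD1 (Ordinal iN))//= big1 ?addr0 => [|j jni].
    rewrite !mulrA fr// eqxx -[f s](proj1 (pf s)) -starM.
    by rewrite (frame_absorb (pf s) fr)// subrr.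
  rewrite !mulrA fr// ifF ?mul0r//; apply: contra_neqF jni => /eqP ij.
  exact/val_inj.
have byx i : (i < n)%N -> bounded_seq (y i).
  by move=> iN; apply: bounded_approx (yx _ iN) (bx _ (ltnW iN)).
have zx : approx z (x n).
  apply: (@approx_trans _ _ (fun s => x n s - \sum_(i < n) 0)); last first.
    by apply: approx_eqW => s; rewrite big1 ?subr0.
  apply: approxB; first exact: approx_refl.
  apply: (@approx_sum _ _ n (fun i s => y i s * (star (y i s) * x n s))
    (fun _ _ => 0)) => i iN.
  apply: (@approx_trans _ _ (fun s => y i s * 0)); last first.
    by apply: approx_eqW => s; rewrite mulr0.
  apply: approxMl; first exact: byx.
  apply: (@approx_trans _ _ (fun s => star (x i s) * x n s)); last first.
    by have := xx i n (ltnW iN) (leqnn _); rewrite ltn_eqF.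
  by apply: approxMr; [exact: bx|exact/approx_star/yx].
have bz : bounded_seq z by apply: bounded_approx zx (bx _ (leqnn _)).
have zzf : approx (fun s => star (z s) * z s) f.
  apply: (@approx_trans _ _ (fun s => star (x n s) * x n s)).
    by apply: approxM => //; [exact: bounded_star|exact: bx|exact: approx_star].
  by have := xx n n (leqnn _) (leqnn _); rewrite eqxx.
have /choice [w hw] s : exists w : A, nrm (f s - star (z s) * z s) <= 16^-1 ->
    [/\ star w * w = f s,
     nrm (w - z s) <= 2 * nrm (z s) * nrm (f s - star (z s) * z s)
    & forall v, v * z s = 0 -> v * w = 0].
  have [h|h] := leP (nrm (f s - star (z s) * z s)) 16^-1; last by exists 0.
  by have [w hw] := normalize (pf s) (zf s) h; exists w.
have {}hw : \forall s \near \oo, [/\ star (w s) * w s = f s,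
     nrm (w s - z s) <= 2 * nrm (z s) * nrm (f s - star (z s) * z s)
    & forall v, v * z s = 0 -> v * w s = 0].
  have e16 : (0 : R) < 16^-1 by rewrite invr_gt0.
  by apply: filterS (approx_sym zzf e16) => s /ltW /hw.
have wz : approx w z.
  have [C zC] := bz; apply: (@approx_le _ _ _ _ _ _ (2 * C) (approx_sym zzf)).
  apply: filterS2 hw zC => s [_ h _] zC; apply: le_trans h _.
  by rewrite ler_wpM2r ?nrm_ge0// ler_pM2l.
exists (fun i => if i == n then w else y i); split.
- by rewrite y0.
- move=> i; rewrite ltnS leq_eqVlt => /predU1P[->|iN].
    by rewrite eqxx; apply: approx_trans wz zx.
  by rewrite ltn_eqF//; apply: yx.
- apply: filterS3 yfr yz hw => s fr hyz [ww _ vw] i j.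
  have yw a : (a < n)%N -> star (y a s) * w s = 0 by move=> aN; rewrite vw ?hyz.
  rewrite !ltnS [(i <= n)%N]leq_eqVlt [(j <= n)%N]leq_eqVlt.
  move=> /predU1P[->|iN] /predU1P[->|jN].
  + by rewrite !eqxx.
  + rewrite eqxx (ltn_eqF jN) [n == j]gtn_eqF//.
    by rewrite -[LHS]starK starM starK yw// star0.
  + by rewrite eqxx (ltn_eqF iN) yw.
  + by rewrite (ltn_eqF iN) (ltn_eqF jN) fr.
Qed.

End Frames.

(** * From approximate towers to exact frames *)

Section TowersToFrames.
Context {R : realType} {A : cstarAlgType R}.
Implicit Types (F : set A).

Definition has_approximate_towers (alpha : A -> A) : Prop :=
  forall (F : set A) (m : nat) (m_gt0 : (0 < m)%N) (eps : R),
    finite_set F -> 0 < eps ->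
    exists (e : 'I_m -> A) (p : A),
      let e0 := e (Ordinal m_gt0) in
      [/\ (forall i, is_projection (e i)) /\ is_partial_isometry p,
          forall i j, i != j -> `|e i * e j| < eps%:C,
          forall i, `|alpha (e i) - e (ordS i)| < eps%:C,
          `|star p * p - (1 - \sum_(i < m) e i)| < eps%:C
            /\ `|p * star p - e0| < eps%:C &
          forall x y, F x -> y = e0 \/ y = p -> `|commutator x y| < eps%:C].

Variable alpha : A -> A.
Hypothesis halpha : is_automorphism alpha.
Hypothesis towers : has_approximate_towers alpha.

(** Choosing data for the tolerances [1 / (s + 1)] turns the approximate
    relations into congruences modulo null sequences.  Indices are natural
    numbers, and towers have length [m.+1] in order to be nonempty. *)
Lemma approximate_tower_sequences F m : finite_set F ->
  exists (E : nat -> nat -> A) (p : nat -> A),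
  [/\ (forall i s, is_projection (E i s)) /\
      (forall s, is_partial_isometry (p s)),
      forall i j, (i < m.+1)%N -> (j < m.+1)%N -> i != j ->
        approx (fun s => E i s * E j s) (fun=> 0),
      (forall i, (i < m)%N -> approx (fun s => alpha (E i s)) (E i.+1)) /\
      approx (fun s => alpha (E m s)) (E 0%N),
      approx (fun s => star (p s) * p s) (fun s => 1 - \sum_(i < m.+1) E i s) /\
      approx (fun s => p s * star (p s)) (E 0%N) &
      forall b, F b -> approx (fun s => b * p s) (fun s => p s * b)].
Proof.
move=> finF.
have /choice [ep hep] s : exists ep : ('I_m.+1 -> A) * A,
  let e := ep.1 in let p := ep.2 in let eps : R := s.+1%:R^-1 in
  [/\ (forall i, is_projection (e i)) /\ is_partial_isometry p,
      forall i j, i != j -> nrm (e i * e j) < eps,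
      forall i, nrm (alpha (e i) - e (ordS i)) < eps,
      nrm (star p * p - (1 - \sum_(i < m.+1) e i)) < eps
        /\ nrm (p * star p - e ord0) < eps &
      forall x, F x -> nrm (x * p - p * x) < eps].
  have [//||e [p [h1 h2 h3 [h4 h5] h6]]] := @towers F m.+1 (ltn0Sn m) (s.+1%:R^-1).
    by rewrite invr_gt0.
  exists (e, p); split => //=.
  - by move=> i j /h2; rewrite ltnrm.
  - by move=> i; rewrite -ltnrm; apply: h3.
  - split; first by rewrite -ltnrm.
    by rewrite -ltnrm (_ : ord0 = Ordinal (ltn0Sn m))//; apply: val_inj.
  - by move=> x Fx; rewrite -ltnrm; apply: h6 => //; right.
have ordSE i : (i < m)%N -> ordS (inord i : 'I_m.+1) = inord i.+1.
  by move=> im; apply: val_inj; rewrite /= !inordK ?modn_small//; exact: ltnW.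
exists (fun i s => (ep s).1 (inord i)), (fun s => (ep s).2); split.
- by split=> [i s|s]; case: (hep s) => -[].
- move=> i j im jm ij; apply: approx_inv => s; rewrite subr0.
  case: (hep s) => _ + _ _ _; apply; apply: contra_neq ij => /(congr1 (@nat_of_ord _)).
  by rewrite !inordK.
- split=> [i im|]; apply: approx_inv => s; case: (hep s) => _ _ h _ _.
    by have := h (inord i); rewrite ordSE.
  have := h (inord m); rewrite (_ : ordS _ = inord 0)//.
  by apply: val_inj; rewrite /= !inordK// modnn.
- split; apply: approx_inv => s; case: (hep s) => _ _ _ [h1 h2] _.
    rewrite (eq_bigr (fun i => (ep s).1 i))// => i _.
    by rewrite inord_val.
  by rewrite (_ : inord 0 = ord0)//; apply: val_inj; rewrite /= inordK.
- by move=> b Fb; apply: approx_inv => s; case: (hep s) => _ _ _ _; apply.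
Qed.

End TowersToFrames.

Section ExactFrames.
Context {R : realType} {A : cstarAlgType R}.
Implicit Types (F : set A) (b : A).
Variable alpha : A -> A.
Hypothesis halpha : is_automorphism alpha.
Hypothesis towers : has_approximate_towers alpha.

Let a i : A -> A := iter i alpha.
Let ha i : is_automorphism (a i) := automorphism_iter i halpha.

(** For [alpha^i p] to commute with [b], [p] has to commute with the preimage
    of [b] under [alpha^i]; for its adjoint to do so as well, the adjoint of
    that preimage is needed too. *)
Lemma finite_backward_orbit F m : finite_set F ->
  exists2 F' : set A, finite_set F' &
    forall b i, F b -> (i <= m)%N ->
      exists b', [/\ F' b', F' (star b') & a i b' = b].
Proof.
move=> finF; exists (\bigcup_(i in `I_m.+1) (a i @^-1` (F `|` star @` F))).
  apply: bigcup_finite; first exact: finite_II.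
  move=> i _; apply: finite_preimage.
    by move=> x y _ _; apply: bij_inj; exact: automorphism_bij.
  by rewrite finite_setU; split => //; exact: finite_image.
move=> b i Fb im; have [g ag ga] := automorphism_bij (ha i).
exists (g b); rewrite ga; split => //; exists i => //=; first by left; rewrite ga.
by right; exists b => //; rewrite (aut_star (ha i)) ga.
Qed.

(** The vectors are [f] and the [P i * f], where [P i] is [alpha^i p].  Their
    inner products come from the ranges: [star (P i) * P j] is close to
    [star (P i) * (E i * E j) * P j], which is small, and [alpha] nearly fixes
    [f], which is close to the complement of a cyclic tower.  The sum of the
    range projections is exactly [1] because its complement is a projection of
    norm less than [1]. *)
Lemma exact_frames F m : finite_set F ->
  exists y : nat -> nat -> A,
  [/\ \forall s \near \oo, [/\ is_projection (y 0%N s),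
        frame (y 0%N s) m.+2 (y^~ s) &
        \sum_(i < m.+2) y i s * star (y i s) = 1],
      approx (fun s => alpha (y 0%N s)) (y 0%N),
      forall i, (0 < i <= m)%N -> approx (fun s => alpha (y i s)) (y i.+1) &
      forall b i, F b -> (i < m.+2)%N ->
        approx (fun s => b * y i s) (fun s => y i s * b) /\
        approx (fun s => b * star (y i s)) (fun s => star (y i s) * b)].
Proof.
move=> /(@finite_backward_orbit F m) [F' finF' FF'].
have [E [p [[pE ip] EE [aE aE0] [pp1 pp2] comm]]] :=
  approximate_tower_sequences towers m finF'.
have [f fE] : exists f : nat -> A, forall s, f s = star (p s) * p s by eexists.
have {}pp1 : approx f (fun s => 1 - \sum_(i < m.+1) E i s).
  exact: approx_trans (approx_eqW fE) pp1.
have pf s : is_projection (f s) by rewrite fE; exact: ip.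
have bE i : bounded_seq (E i).
  by exists 1; apply: nearW => s; exact/nrm_projection.
have bf : bounded_seq f by exists 1; apply: nearW => s; exact/nrm_projection.
have bp : bounded_seq p.
  by exists 1; apply: nearW => s; exact/nrm_partial_isometry/ip.
have b1 (c : A) : bounded_seq (fun=> c) by exact: bounded_cst.
pose P i s := a i (p s).
have bP i : bounded_seq (P i) by exact: bounded_aut.
have bPs i : bounded_seq (fun s => star (P i s)) by exact: bounded_star.
have PP i : (i <= m)%N -> approx (fun s => P i s * star (P i s)) (E i).
  elim: i => [//|i IHi] im; apply: (approx_trans _ (aE _ im)).
  apply: (approx_trans _ (approx_aut halpha (IHi (ltnW im)))).
  by apply: approx_eqW => s; rewrite (autM halpha) (aut_star halpha).
have alphaf : approx (fun s => alpha (f s)) f.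
  apply: approx_trans (approx_aut halpha pp1) _.
  apply: (approx_trans _ (approx_sym pp1)).
  apply: (@approx_trans _ _ (fun s => 1 - (\sum_(i < m) alpha (E i s) + alpha (E m s)))).
    by apply: approx_eqW => s; rewrite (autB halpha) (aut1 halpha)
      (aut_sum halpha) big_ord_recr.
  apply: (@approx_trans _ _ (fun s => 1 - (\sum_(i < m) E i.+1 s + E 0%N s))).
    apply: approxB; first exact: approx_refl.
    apply: approxD => //.
    apply: (@approx_sum _ _ m (fun i s => alpha (E i s)) (fun i => E i.+1)) => i.
    exact: aE.
  by apply: approx_eqW => s; rewrite big_ord_recl; congr (1 - _); rewrite addrC.
have aif i : approx (fun s => a i (f s)) f.
  elim: i => [|i IHi]; first exact: approx_refl.
  apply: (approx_trans _ alphaf); exact: (approx_aut halpha IHi).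
have PPP i s : P i s * star (P i s) * P i s = P i s.
  by rewrite -mulrA; apply: partial_isometryE; rewrite /is_partial_isometry
    -(aut_star (ha i)) -(autM (ha i)); exact/(aut_projection (ha i))/ip.
have EP i : (i <= m)%N -> approx (fun s => E i s * P i s) (P i).
  move=> im; apply: (@approx_trans _ _ (fun s => P i s * star (P i s) * P i s)).
    by apply: approxMr => //; apply/approx_sym/PP.
  exact/approx_eqW/PPP.
pose x i := if i is j.+1 then fun s => P j s * f s else f.
have xf i s : x i s * f s = x i s.
  by case: i => [|i] /=; rewrite -?mulrA (proj2 (pf s)).
have fE0 i : (i <= m)%N -> approx (fun s => f s * E i s) (fun=> 0).
  move=> im; apply: (@approx_trans _ _
      (fun s => (1 - \sum_(j < m.+1) E j s) * E i s)); first exact: approxMr.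
  apply: (@approx_trans _ _ (fun s => E i s - (\sum_(j < m.+1)
      if i == j then E i s else 0))).
    apply: (@approx_trans _ _ (fun s => E i s - (\sum_(j < m.+1)
      E j s * E i s))).
      by apply: approx_eqW => s; rewrite mulrBl mul1r mulr_suml.
    apply: approxB; first exact: approx_refl.
    apply: (@approx_sum _ _ m.+1 (fun j s => E j s * E i s)
        (fun j s => if i == j then E i s else 0)) => j jm.
    case: eqVneq => [<-|ij]; last by apply: EE; rewrite // eq_sym.
    by apply: approx_eqW => s; rewrite (proj2 (pE i s)).
  apply: approx_eqW => s; rewrite (bigD1 (inord i))//= inordK// eqxx.
  rewrite big1 ?addr0 ?subrr// => j ij; rewrite ifF//.
  by apply: contra_neqF ij => /eqP ->; rewrite inord_val.
have fP i : (i <= m)%N -> approx (fun s => f s * P i s) (fun=> 0).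
  move=> im; apply: (@approx_trans _ _ (fun s => f s * E i s * P i s)).
    apply: (@approx_trans _ _ (fun s => f s * (E i s * P i s))).
      by apply: approxMl => //; apply/approx_sym/EP.
    by apply: approx_eqW => s; rewrite mulrA.
  apply: (@approx_trans _ _ (fun s => 0 * P i s)).
    by apply: approxMr => //; exact: fE0.
  by apply: approx_eqW => s; rewrite mul0r.
have PiPj i j : (i <= m)%N -> (j <= m)%N -> i != j ->
    approx (fun s => star (P i s) * P j s) (fun=> 0).
  move=> im jm ij; apply: (@approx_trans _ _
      (fun s => star (E i s * P i s) * (E j s * P j s))).
    apply/approx_sym/approxM => //; last exact: EP.
      by apply: bounded_star; exact: boundedM.
    exact/approx_star/EP.
  apply: (@approx_trans _ _ (fun s => star (P i s) * (E i s * E j s * P j s))).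
    by apply: approx_eqW => s; rewrite starM (proj1 (pE i s)) !mulrA.
  apply: (@approx_trans _ _ (fun s => star (P i s) * (0 * P j s))).
    by apply: approxMl => //; apply: approxMr => //; exact: EE.
  by apply: approx_eqW => s; rewrite mul0r mulr0.
have PiPi i : approx (fun s => star (P i s) * P i s) f.
  apply: (approx_trans _ (aif i)).
  by apply: approx_eqW => s; rewrite fE (autM (ha i)) (aut_star (ha i)).
have x0x j : (j <= m)%N -> approx (fun s => star (x 0%N s) * x j.+1 s) (fun=> 0).
  move=> jm; apply: (@approx_trans _ _ (fun s => f s * P j s * f s)).
    by apply: approx_eqW => s /=; rewrite (proj1 (pf s)) mulrA.
  apply: (@approx_trans _ _ (fun s => 0 * f s)).
    by apply: approxMr => //; exact: fP.
  by apply: approx_eqW => s; rewrite mul0r.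
have xx i j : (i < m.+2)%N -> (j < m.+2)%N ->
    approx (fun s => star (x i s) * x j s) (fun s => if i == j then f s else 0).
  case: i j => [|i] [|j] im jm.
  - by apply: approx_eqW => s; have [sf ff] := pf s; rewrite /= sf ff.
  - exact: x0x.
  - apply: (@approx_trans _ _ (fun s => star (star (x 0%N s) * x i.+1 s))).
      by apply: approx_eqW => s; rewrite starM starK.
    apply: (@approx_trans _ _ (fun s => star 0)); last first.
      by apply: approx_eqW => s; rewrite star0.
    by apply: approx_star; exact: x0x.
  - apply: (@approx_trans _ _ (fun s => f s * ((star (P i s) * P j s) * f s))).
      apply: approx_eqW => s /=.
      by rewrite starM (proj1 (pf s)) !mulrA.
    apply: (@approx_trans _ _ (fun s => f s * ((if i == j then f s else 0) * f s))).
      apply: approxMl => //; apply: approxMr => //.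
      by case: eqVneq => [<-|ij]; [exact: PiPi|exact: PiPj].
    apply: approx_eqW => s; rewrite eqSS; case: eqP => _.
      by rewrite !(proj2 (pf s)).
    by rewrite mul0r mulr0.
have [y [y0 yx yfr]] := @gram_schmidt _ _ m.+1 f x pf erefl (fun i s _ => xf i s) xx.
have bx i : bounded_seq (x i) by case: i => [|i] //=; exact: boundedM.
have by_ i : (i < m.+2)%N -> bounded_seq (y i).
  by move=> im; apply: bounded_approx (yx i im) (bx i).
exists y; split.
- have sum1 : approx (fun s => 1 - \sum_(i < m.+2) y i s * star (y i s)) (fun=> 0).
    apply: (@approx_trans _ _ (fun s => 1 - \sum_(i < m.+2) x i s * star (x i s))).
      apply: approxB; first exact: approx_refl.
      apply: (@approx_sum _ _ m.+2 (fun i s => y i s * star (y i s))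
        (fun i s => x i s * star (x i s))) => i im.
      apply: approxM; [exact: by_|exact: bounded_star|exact: yx|].
      exact/approx_star/yx.
    apply: (@approx_trans _ _ (fun s => 1 - (f s + \sum_(i < m.+1) E i s))).
      apply: (@approx_trans _ _
          (fun s => 1 - (f s + \sum_(i < m.+1) P i s * f s * star (P i s)))).
        apply: approx_eqW => s; rewrite big_ord_recl /=; have [sf ff] := pf s.
        rewrite sf ff; congr (_ - (_ + _)); apply: eq_bigr => i _.
        by rewrite starM sf !mulrA -(mulrA (P i s) (f s) (f s)) ff.
      apply: approxB; first exact: approx_refl.
      apply: approxD; first exact: approx_refl.
      apply: (@approx_sum _ _ m.+1 (fun i s => P i s * f s * star (P i s)) E) => i im.
      apply: (approx_trans _ (PP i im)).
      apply: (@approx_trans _ _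
        (fun s => P i s * (star (P i s) * P i s) * star (P i s))).
        apply: approxMr => //; apply: approxMl => //; exact/approx_sym/PiPi.
      by apply: approx_eqW => s; rewrite !mulrA PPP.
    apply: (@approx_trans _ _ (fun s => 1 - (1 - \sum_(i < m.+1) E i s
        + \sum_(i < m.+1) E i s))).
      apply: approxB; first exact: approx_refl.
      by apply: approxD => //; exact: approx_refl.
    by apply: approx_eqW => s; rewrite subrK subrr.
  apply: filterS2 yfr (sum1 _ ltr01) => s fr; rewrite subr0 => lt1.
  rewrite y0 in fr *; split => //; apply/esym/eqP; rewrite -subr_eq0; apply/eqP.
  apply: projection_eq0 => //; apply: projectionC.
  exact: (frame_sum_projection (pf s) fr).
- by rewrite y0.
- case=> // i /= im; apply: (@approx_trans _ _ (fun s => alpha (x i.+1 s))).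
    by apply: approx_aut => //; apply: yx; exact: ltnW.
  apply: (approx_trans _ (approx_sym (yx i.+2 _))) => //.
  apply: (@approx_trans _ _ (fun s => P i.+1 s * alpha (f s))).
    by apply: approx_eqW => s; rewrite /= (autM halpha).
  exact: approxMl.
- move=> b i Fb im.
  have comm_star c (u : nat -> A) :
      approx (fun s => star c * u s) (fun s => u s * star c) ->
      approx (fun s => c * star (u s)) (fun s => star (u s) * c).
    move=> /approx_star/approx_sym cu.
    apply: approx_trans (approx_trans cu _); apply: approx_eqW => s;
      by rewrite starM starK.
  have pc j c : (j <= m)%N -> c = b \/ c = star b ->
      approx (fun s => c * P j s) (fun s => P j s * c).
    move=> jm hc; have [b' [Fb' Fsb' jb']] := FF' _ _ Fb jm.
    have [c' Fc' <-] : exists2 c', F' c' & a j c' = c.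
      by case: hc => ->; [exists b'|exists (star b')];
        rewrite // (aut_star (ha j)) jb'.
    apply: (@approx_trans _ _ (fun s => a j (c' * p s))).
      by apply: approx_eqW => s; rewrite (autM (ha j)).
    apply: (@approx_trans _ _ (fun s => a j (p s * c'))).
      by apply: (approx_aut (ha j)); exact: comm.
    by apply: approx_eqW => s; rewrite (autM (ha j)).
  have fc c : c = b \/ c = star b -> approx (fun s => c * f s) (fun s => f s * c).
    move=> hc; apply: (@approx_trans _ _ (fun s => c * (star (p s) * p s))).
      by apply: approx_eqW => s; rewrite fE.
    apply: (@approx_trans _ _ (fun s => star (p s) * p s * c)); last first.
      by apply: approx_eqW => s; rewrite fE.
    apply: approx_commM => //; [exact: bounded_star| |exact: (pc 0%N)].
    apply: comm_star; apply: (pc 0%N) => //.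
    by case: hc => ->; [right|left; rewrite starK].
  have yc c : c = b \/ c = star b ->
      approx (fun s => c * y i s) (fun s => y i s * c).
    move=> hc; apply: (@approx_trans _ _ (fun s => c * x i s)).
      by apply: approxMl => //; exact: yx.
    apply: (@approx_trans _ _ (fun s => x i s * c)); last first.
      by apply: approxMr => //; apply/approx_sym/yx.
    case: i im => [|i] im /=; first exact: fc.
    by apply: approx_commM => //; [exact: pc|exact: fc].
  split; first by apply: yc; left.
  by apply: comm_star; apply: yc; right.
Qed.

End ExactFrames.

(** * Residue classes and averages *)

Section Blocks.
Context {R : realType} {A : cstarAlgType R}.
Implicit Types (P : nat -> A).

Definition block n K P (j : nat) : A := \sum_(l < n) P (l * K + j)%N.

Lemma block_sum n K P : \sum_(j < K) block n K P j = \sum_(i < n * K) P i.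
Proof.
rewrite exchange_big /=; elim: n => [|n IHn]; first by rewrite !big_ord0.
rewrite big_ord_recr IHn mulSn addnC /= big_split_ord /=.
by congr (_ + _); apply: eq_bigr.
Qed.

Lemma block_bound n K l j : (l < n)%N -> (j < K)%N -> (l * K + j < n * K)%N.
Proof. by move=> ln jK; nia. Qed.

Lemma block_inj K l l' i j : (i < K)%N -> (j < K)%N ->
  (l * K + i == l' * K + j)%N = (l == l') && (i == j).
Proof.
move=> iK jK; apply/eqP/andP => [e|[/eqP -> /eqP ->]//].
have K0 : (0 < K)%N by case: K iK {jK e}.
have := congr1 (divn^~ K) e; have := congr1 (modn^~ K) e.
rewrite !modnMDl !modn_small// => ->.
by rewrite !divnMDl// !divn_small// !addn0 => ->.
Qed.

(** Cutting a cycle of length [n * K] into blocks wraps it [n] times around a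
    cycle of length [K]. *)
Lemma block_shift n K P j : (0 < n)%N -> (j < K)%N ->
  \sum_(l < n) P ((l * K + j).+1 %% (n * K))%N = block n K P (j.+1 %% K)%N.
Proof.
case: n => // n _ jK; have [jK1|] := ltnP j.+1 K.
  apply: eq_bigr => l _; rewrite -addnS (modn_small jK1) modn_small//.
  exact: block_bound.
move=> Kj; have -> : K = j.+1 by apply/eqP; rewrite eqn_leq Kj.
rewrite modnn /block big_ord_recr big_ord_recl /= addrC; congr (_ + _).
  by rewrite -addnS -mulSnr modnn.
apply: eq_bigr => l _; rewrite -addnS -mulSnr addn0 modn_small//.
by rewrite ltn_pmul2r// ltnS.
Qed.

Definition orthogonal_projections N P : Prop :=
  (forall i, (i < N)%N -> is_projection (P i)) /\
  forall i j, (i < N)%N -> (j < N)%N -> i != j -> P i * P j = 0.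

Lemma block_projections n K P : orthogonal_projections (n * K) P ->
  orthogonal_projections K (block n K P).
Proof.
move=> [pP oP]; split=> [j jK|i j iK jK ij].
  split; first by rewrite star_sum; apply: eq_bigr => l _;
    case: (pP (l * K + j)%N (block_bound (ltn_ord l) jK)).
  rewrite {2}/block mulr_suml; apply: eq_bigr => l _.
  rewrite mulr_sumr (bigD1 l)//= big1 ?addr0 => [|l' l'l].
    by case: (pP (l * K + j)%N (block_bound (ltn_ord l) jK)).
  by rewrite oP ?block_bound// block_inj// eqxx andbT eq_sym.
rewrite mulr_suml big1// => l _; rewrite mulr_sumr big1// => l' _.
by rewrite oP ?block_bound// block_inj// (negbTE ij) andbF.
Qed.

Lemma frame_projections f N y : is_projection f -> frame f N y ->
  orthogonal_projections N (fun i => y i * star (y i)).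
Proof.
move=> pf fr; split=> [i iN|i j iN jN ij].
  split; first by rewrite starM starK.
  by rewrite mulrA -(mulrA (y i)) fr// eqxx (frame_absorb pf fr).
by rewrite mulrA -(mulrA (y i)) fr// (negbTE ij) mulr0 mul0r.
Qed.

End Blocks.

Section AveragedFrame.
Context {R : realType} {A : cstarAlgType R}.
Variables (f : A) (v : nat -> A) (n K : nat).
Hypothesis pf : is_projection f.
Hypothesis n0 : (0 < n)%N.
Hypothesis fr : frame f (n * K) v.

Let E := block n K (fun i => v i * star (v i)).
Let w i := ((Num.sqrt n%:R)^-1)%:C *: block n K v i.

(** The factor [n^(-1/2)] normalizes a sum of [n] orthonormal vectors. *)
Lemma averaged_frame : frame f K w.
Proof.
move=> i j iK jK; rewrite /w starZr balgZl balgZr scalerA -realCM -invfM.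
rewrite -expr2 sqr_sqrtr ?ler0n// star_sum.
have -> : (\sum_(l < n) star (v (l * K + i)%N)) * block n K v j =
    if i == j then n%:R%:C *: f else 0.
  rewrite mulr_suml; under eq_bigr => l _ do rewrite mulr_sumr.
  case: eqVneq => [<-|ij]; last first.
    rewrite big1// => l _; rewrite big1// => l' _.
    by rewrite fr ?block_bound// block_inj// (negbTE ij) andbF.
  under eq_bigr => l _.
    rewrite (bigD1 l)//= big1 ?addr0 => [|l' l'l].
      rewrite fr ?block_bound// eqxx; over.
    by rewrite fr ?block_bound// block_inj// eqxx andbT eq_sym ifF//; exact: negbTE.
  rewrite sumr_const card_ord -scaler_nat; congr (_ *: _).
  by rewrite (rmorph_nat (real_complex R)).
case: eqP => _; last by rewrite scaler0.
by rewrite scalerA -realCM mulVf ?scale1r// pnatr_eq0 -lt0n.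
Qed.

(** The averaged vector [w i] lies in the range of [E i], which is what makes
    [E i - w i * star (w i)] a projection. *)
Lemma block_range i j : (i < K)%N -> (j < K)%N ->
  E i * w j = if i == j then w j else 0.
Proof.
move=> iK jK; rewrite /w balgZr /E {2}/block mulr_sumr.
have Ev l : (l < n)%N ->
    block n K (fun i => v i * star (v i)) i * v (l * K + j)%N =
    if i == j then v (l * K + j)%N else 0.
  move=> ln; rewrite /block mulr_suml; case: eqVneq => [->|ij].
    rewrite (bigD1 (Ordinal ln))//= big1 ?addr0 => [|l' l'l].
      by rewrite -mulrA fr ?block_bound// eqxx (frame_absorb pf fr)// block_bound.
    rewrite -mulrA fr ?block_bound// block_inj// eqxx andbT ifF ?mulr0//.
    exact: negbTE.
  rewrite big1// => l' _; rewrite -mulrA fr ?block_bound// block_inj//.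
  by rewrite (negbTE ij) andbF mulr0.
case: eqP Ev => ij Ev; last first.
  by rewrite big1 ?scaler0// => l _; exact: Ev.
by congr (_ *: _); apply: eq_bigr => l _; exact: Ev.
Qed.

Lemma averaged_complement :
  orthogonal_projections K (fun i => E i - w i * star (w i)).
Proof.
have [pE oE] : orthogonal_projections K E.
  exact/block_projections/(frame_projections pf fr).
have [pw ow] := frame_projections pf averaged_frame.
split=> [i iK|i j iK jK ij].
  apply: projectionB; [exact: pE|exact: pw|].
  by rewrite mulrA block_range// eqxx.
have Ew a b : (a < K)%N -> (b < K)%N -> a != b -> E a * (w b * star (w b)) = 0.
  by move=> aK bK ab; rewrite mulrA block_range// (negbTE ab) mul0r.
have wE : w i * star (w i) * E j = 0.
  rewrite -[LHS]starK starM (proj1 (pE j jK)) (proj1 (pw i iK)).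
  by rewrite Ew ?star0// eq_sym.
by rewrite mulrBl !mulrBr oE// Ew// wE ow// !subr0.
Qed.

End AveragedFrame.

(** * Cyclic frames *)

Section CyclicFrames.
Context {R : realType} {A : cstarAlgType R}.
Implicit Types (F : set A) (b f : A) (w D : nat -> A).
Variable alpha : A -> A.
Hypothesis halpha : is_automorphism alpha.
Hypothesis towers : has_approximate_towers alpha.

Definition frame_cons f w t : A := if t is i.+1 then w i else f.

(** An orthonormal basis [w] permuted cyclically, next to a vector [f] which is
    fixed, with a cyclic tower [D] filling the complement of their span. *)
Definition cyclic_frame F K (e : R) f w D : Prop :=
  [/\ [/\ is_projection f, frame f K.+1 (frame_cons f w),
         orthogonal_projections K D &
         f + \sum_(i < K) w i * star (w i) + \sum_(i < K) D i = 1],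
      nrm (alpha f - f) < e,
      forall i, (i < K)%N -> nrm (alpha (w i) - w (i.+1 %% K)%N) < e,
      forall i, (i < K)%N -> nrm (alpha (D i) - D (i.+1 %% K)%N) < e &
      forall b, F b ->
        nrm (b * f - f * b) < e /\ forall i, (i < K)%N ->
        [/\ nrm (b * w i - w i * b) < e,
            nrm (b * star (w i) - star (w i) * b) < e &
            nrm (b * D i - D i * b) < e]].

Lemma nrm_range_dist (x y : A) :
  nrm (x * star x - y * star y) <= (nrm x + nrm y) * nrm (x - y).
Proof.
have -> : x * star x - y * star y = x * star (x - y) + (x - y) * star y.
  by rewrite starB mulrBr mulrBl subrKA.
have := nrmD (x * star (x - y)) ((x - y) * star y).
have := nrmM x (star (x - y)); have := nrmM (x - y) (star y).
by rewrite !nrm_star; lra.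
Qed.

Lemma approx_block n K (T S : nat -> nat -> A) i : (i < K)%N ->
  (forall j, (j < n * K)%N -> approx (T j) (S j)) ->
  approx (fun s => block n K (T^~ s) i) (fun s => block n K (S^~ s) i).
Proof.
move=> iK TS; apply: (@approx_sum _ _ n (fun l => T (l * K + i)%N)
  (fun l => S (l * K + i)%N)) => l ln; apply: TS; exact: block_bound.
Qed.

Lemma approx_block_aut n K (T S : nat -> nat -> A) i : (0 < n)%N -> (i < K)%N ->
  (forall j, (j < n * K)%N ->
    approx (fun s => alpha (T j s)) (S (j.+1 %% (n * K))%N)) ->
  approx (fun s => alpha (block n K (T^~ s) i))
         (fun s => block n K (S^~ s) (i.+1 %% K)%N).
Proof.
move=> n0 iK TS.
apply: (@approx_trans _ _ (fun s => block n K (fun j => alpha (T j s)) i)).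
  by apply: approx_eqW => s; rewrite (aut_sum halpha).
apply: (@approx_trans _ _ (fun s =>
  block n K (fun j => S (j.+1 %% (n * K))%N s) i)).
  exact: (approx_block iK TS).
by apply: approx_eqW => s; rewrite -(block_shift _ n0 iK).
Qed.

Lemma approx_block_comm n K b (T : nat -> nat -> A) i : (i < K)%N ->
  (forall j, (j < n * K)%N -> approx (fun s => b * T j s) (fun s => T j s * b)) ->
  approx (fun s => b * block n K (T^~ s) i) (fun s => block n K (T^~ s) i * b).
Proof.
move=> iK Tc.
apply: (@approx_trans _ _ (fun s => block n K (fun j => b * T j s) i)).
  by apply: approx_eqW => s; rewrite mulr_sumr.
apply: (@approx_trans _ _ (fun s => block n K (fun j => T j s * b) i)).
  exact: (approx_block iK Tc).
by apply: approx_eqW => s; rewrite mulr_suml.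
Qed.

Lemma exists_small_invsqrt (e : R) : 0 < e ->
  exists n, (0 < n)%N /\ (Num.sqrt n%:R)^-1 < e.
Proof.
move=> e0; have h0 : 0 <= (e^-1) ^+ 2 by rewrite sqr_ge0.
exists (Num.bound (e^-1 ^+ 2)); have lt := archi_boundP h0.
have n0 : (0 : R) < (Num.bound (e^-1 ^+ 2))%:R by exact: le_lt_trans h0 lt.
split; first by rewrite -(ltr0n R).
rewrite invf_plt ?posrE ?sqrtr_gt0// -ltr_sqrt// in lt *.
by rewrite sqrtr_sqr ger0_norm ?invr_ge0 ?ltW in lt.
Qed.

(** The chain [y 1], ..., [y (n * K)] of [exact_frames] is cut in blocks of
    length [K] which are averaged.  Every step of the chain is controlled but
    the last, and that one contributes only [n^(-1/2)] times a vector of norm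
    at most [3]. *)
Lemma exists_cyclic_frame F K e : (0 < K)%N -> finite_set F -> 0 < e ->
  exists f w D, cyclic_frame F K e f w D.
Proof.
move=> K0 finF e0.
have [[|n] [// _ rn]] : exists n, (0 < n)%N /\ (Num.sqrt n%:R)^-1 < e / 32.
  by apply: exists_small_invsqrt; lra.
have [m mE] : exists m, (n.+1 * K = m.+1)%N.
  by exists (n.+1 * K).-1; rewrite prednK ?muln_gt0.
have [y [yfr alphaf alphay ycomm]] := exact_frames halpha towers m finF.
pose f := y 0%N; pose v i := y i.+1.
have {}yfr : \forall s \near \oo, [/\ is_projection (f s),
    frame (f s) m.+2 (y^~ s), frame (f s) (n.+1 * K) (v^~ s) &
    f s + \sum_(i < m.+1) v i s * star (v i s) = 1].
  apply: filterS yfr => s [pf fr sum1]; split=> //.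
    by move=> i j; rewrite mE => im jm; rewrite fr.
  have [sf ff] := pf; rewrite -sum1 [RHS]big_ord_recl /=.
  by rewrite -/(f s) sf ff.
have bf : bounded_seq f.
  by exists 1; apply: filterS yfr => s [pf _ _ _]; exact: nrm_projection.
have bv i : (i < m.+1)%N -> bounded_seq (v i).
  move=> im; exists 1; apply: filterS yfr => s [pf _ fr _].
  by apply: (frame_nrm pf fr); rewrite mE.
pose Q i s := v i s * star (v i s).
have alphav i : (i < m)%N -> approx (fun s => alpha (v i s)) (v i.+1).
  by move=> im; apply: alphay.
(* unlike the last vector, its range projection is controlled: [alpha] maps it
   to what the images of the others leave free in [1 - f] *)
have alphaQ i : (i < m.+1)%N ->
    approx (fun s => alpha (Q i s)) (Q (i.+1 %% m.+1)%N).
  have lt_case j : (j < m)%N -> approx (fun s => alpha (Q j s)) (Q j.+1).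
    move=> jm; apply: (@approx_trans _ _
      (fun s => alpha (v j s) * star (alpha (v j s)))).
      by apply: approx_eqW => s; rewrite (autM halpha) (aut_star halpha).
    apply: approxM; [|exact/bounded_star/bv|exact: alphav|exact/approx_star/alphav].
    by apply: bounded_aut => //; apply: bv; exact: ltnW.
  rewrite ltnS leq_eqVlt => /predU1P[->|im]; last first.
    by rewrite modn_small//; exact: lt_case.
  have subE (a c d : A) : a + (c + d) - a - c = d.
    by rewrite [a + _]addrC addrK addrC addKr.
  rewrite modnn.
  apply: (@approx_trans _ _ (fun s => 1 - alpha (f s) - \sum_(j < m) alpha (Q j s))).
    apply: approx_eq; apply: filterS yfr => s [_ _ _ sum1].
    rewrite -(aut1 halpha) -sum1 big_ord_recr !(autD halpha) (aut_sum halpha) /=.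
    exact/esym/subE.
  apply: (@approx_trans _ _ (fun s => 1 - f s - \sum_(j < m) Q j.+1 s)).
    apply: approxB; first by apply: approxB; [exact: approx_refl|].
    by apply: (@approx_sum _ _ m (fun j s => alpha (Q j s)) (fun j => Q j.+1)).
  apply: approx_eq; apply: filterS yfr => s [_ _ _ sum1].
  rewrite -sum1 big_ord_recl /= [v 0%N s * _ + _]addrC; exact: subE.
pose w i s := ((Num.sqrt n.+1%:R)^-1)%:C *: block n.+1 K (v^~ s) i.
pose E i s := block n.+1 K (Q^~ s) i.
pose D i s := E i s - w i s * star (w i s).
pose next i := (i.+1 %% K)%N.
have blockM l i : (l < n.+1)%N -> (i < K)%N -> (l * K + i < m.+1)%N.
  by rewrite -mE; exact: block_bound.
have alphaE i : (i < K)%N -> approx (fun s => alpha (E i s)) (E (next i)).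
  by move=> iK; apply: approx_block_aut => // j; rewrite mE; exact: alphaQ.
have e8 : 0 < e / 8 by lra.
have alphaw : \forall s \near \oo, forall i, (i < K)%N ->
    nrm (alpha (w i s) - w (next i) s) < e / 8.
  have av : \forall s \near \oo, forall i, (i < m)%N ->
      nrm (alpha (v i s) - v i.+1 s) < n.+1%:R^-1.
    by apply: near_forall_lt => i /alphav; apply; rewrite invr_gt0.
  apply: filterS2 av yfr => s av [pf _ fr _] i iK.
  rewrite /w (autZ halpha) -scalerBr nrmZr ger0_norm ?invr_ge0 ?sqrtr_ge0//.
  rewrite (aut_sum halpha) -(block_shift _ _ iK)// -sumrB big_ord_recr /=.
  set S := \sum_(l < n) _; set x := alpha _ - _.
  have S1 : nrm S <= 1.
    have -> : (1 : R) = n.+1%:R * n.+1%:R^-1 by rewrite mulfV ?pnatr_eq0.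
    apply: le_trans (_ : n%:R * n.+1%:R^-1 <= _); last first.
      by rewrite ler_wpM2r ?invr_ge0// ler_nat.
    apply: (@nrm_sum_le _ _ n (fun l => alpha (v (l * K + i)%N s)
      - v ((l * K + i).+1 %% (n.+1 * K))%N s)) => l ln.
    have lM : ((l * K + i).+1 < m.+1)%N by rewrite -mE; nia.
    by rewrite mE modn_small// ltW// av.
  have x3 : nrm x <= 3.
    have v1 j : (j < n.+1 * K)%N -> nrm (v j s) <= 1 by apply: (frame_nrm pf fr).
    have h1 : nrm (v (n * K + i)%N s) <= 1 by apply: v1; exact: block_bound.
    have h2 : nrm (v ((n * K + i).+1 %% (n.+1 * K))%N s) <= 1.
      by apply: v1; rewrite ltn_mod muln_gt0.
    have := nrmB (alpha (v (n * K + i)%N s)) (v ((n * K + i).+1 %% (n.+1 * K))%N s).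
    by have := nrm_aut (v (n * K + i)%N s) halpha; rewrite /x; lra.
  have := nrmD S x; have := nrm_ge0 (S + x).
  have : 0 <= (Num.sqrt n.+1%:R)^-1 :> R by rewrite invr_ge0 sqrtr_ge0.
  by nra.
have {}alphaE : \forall s \near \oo, forall i, (i < K)%N ->
    nrm (alpha (E i s) - E (next i) s) < e / 8.
  by apply: near_forall_lt => i /alphaE; apply.
have comms : \forall s \near \oo, forall b, F b ->
    nrm (b * f s - f s * b) < e /\ forall i, (i < K)%N ->
    [/\ nrm (b * w i s - w i s * b) < e,
        nrm (b * star (w i s) - star (w i s) * b) < e &
        nrm (b * D i s - D i s * b) < e].
  apply: near_forall_finite => // b Fb.
  have fc := (ycomm b 0%N Fb isT).1.
  have vc i : (i < m.+1)%N -> approx (fun s => b * v i s) (fun s => v i s * b).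
    by move=> im; exact: (ycomm b i.+1 Fb im).1.
  have vsc i : (i < m.+1)%N ->
      approx (fun s => b * star (v i s)) (fun s => star (v i s) * b).
    by move=> im; exact: (ycomm b i.+1 Fb im).2.
  have blockc (T : nat -> nat -> A) i : (i < K)%N ->
      (forall j, (j < m.+1)%N -> approx (fun s => b * T j s) (fun s => T j s * b)) ->
      approx (fun s => b * block n.+1 K (T^~ s) i) (fun s => block n.+1 K (T^~ s) i * b).
    by rewrite -mE; exact: approx_block_comm.
  have wc i : (i < K)%N -> approx (fun s => b * w i s) (fun s => w i s * b).
    move=> iK; rewrite /w; apply: (@approx_trans _ _ (fun s =>
      ((Num.sqrt n.+1%:R)^-1)%:C *: (b * block n.+1 K (v^~ s) i))).
      by apply: approx_eqW => s; rewrite balgZr.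
    apply: (@approx_trans _ _ (fun s =>
      ((Num.sqrt n.+1%:R)^-1)%:C *: (block n.+1 K (v^~ s) i * b))).
      by apply: approxZ; exact: blockc.
    by apply: approx_eqW => s; rewrite balgZl.
  have wsc i : (i < K)%N ->
      approx (fun s => b * star (w i s)) (fun s => star (w i s) * b).
    move=> iK; rewrite /w; apply: (@approx_trans _ _ (fun s =>
      ((Num.sqrt n.+1%:R)^-1)%:C *: (b * block n.+1 K (fun j => star (v j s)) i))).
      by apply: approx_eqW => s; rewrite starZr balgZr star_sum.
    apply: (@approx_trans _ _ (fun s =>
      ((Num.sqrt n.+1%:R)^-1)%:C *: (block n.+1 K (fun j => star (v j s)) i * b))).
      by apply: approxZ; apply: (blockc (fun j s => star (v j s))).
    by apply: approx_eqW => s; rewrite starZr balgZl star_sum.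
  have bw i : (i < K)%N -> bounded_seq (w i).
    move=> iK; exists 1; apply: filterS yfr => s [pf _ fr _].
    by apply: (frame_nrm pf (averaged_frame _ fr)).
  have Dc i : (i < K)%N -> approx (fun s => b * D i s) (fun s => D i s * b).
    move=> iK; apply: (@approx_trans _ _
      (fun s => b * E i s - b * (w i s * star (w i s)))).
      by apply: approx_eqW => s; rewrite mulrBr.
    apply: (@approx_trans _ _ (fun s => E i s * b - w i s * star (w i s) * b)).
      apply: approxB.
        apply: blockc => // j jm; apply: approx_commM;
          [exact: bv|exact/bounded_star/bv|exact: vc|exact: vsc].
      by apply: approx_commM;
        [exact: bw|exact/bounded_star/bw|exact: wc|exact: wsc].
    by apply: approx_eqW => s; rewrite mulrBl.
  have all : \forall s \near \oo, forall i, (i < K)%N ->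
      [/\ nrm (b * w i s - w i s * b) < e,
        nrm (b * star (w i s) - star (w i s) * b) < e &
        nrm (b * D i s - D i s * b) < e].
    apply: near_forall_lt => i iK.
    by apply: filterS3 (wc i iK e e0) (wsc i iK e e0) (Dc i iK e e0).
  by apply: filterS2 (fc e e0) all.
have : \forall s \near \oo, cyclic_frame F K e (f s) (w^~ s) (D^~ s).
  apply: filter_app comms; apply: filter_app alphaE; apply: filter_app alphaw.
  apply: filterS2 yfr (alphaf e e0) => s [pf fry fr sum1] af alphaw alphaE comms.
  have frw : frame (f s) K (w^~ s) by exact: (averaged_frame _ fr).
  have fv i : (i < m.+1)%N -> f s * v i s = 0.
    by move=> im; rewrite -[f s](proj1 pf) (fry 0%N i.+1).
  have fw i : (i < K)%N -> star (f s) * w i s = 0.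
    move=> iK; rewrite (proj1 pf) balgZr mulr_sumr big1 ?scaler0// => l _.
    by apply: fv; exact: blockM.
  split=> //.
  - split=> //.
    + move=> [|i] [|j] iK jK; [|exact: fw| |exact: frw].
        by rewrite /= (proj1 pf) (proj2 pf).
      by rewrite -[LHS]starK starM starK fw// star0.
    + exact: (averaged_complement pf _ fr).
    + rewrite -addrA -big_split /=.
      rewrite (eq_bigr (fun i : 'I_K => E i s)) => [|i _].
        by rewrite block_sum mE.
      by rewrite /D addrC subrK.
  - by move=> i iK; apply: lt_trans (alphaw i iK) _; lra.
  - move=> i iK; have nK : (next i < K)%N by rewrite ltn_mod.
    have := alphaE i iK; have := alphaw i iK.
    have w1 := frame_nrm pf frw iK; have w1' := frame_nrm pf frw nK.
    have aw2 := nrm_aut (w i s) halpha.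
    have := nrm_range_dist (alpha (w i s)) (w (next i) s).
    set x := alpha (w i s) * _ - _ => h1 h2 h3.
    have -> : alpha (D i s) - D (next i) s = alpha (E i s) - E (next i) s - x.
      rewrite /D /x (autB halpha) (autM halpha) (aut_star halpha).
      by rewrite !opprD !opprK addrACA.
    have := nrmB (alpha (E i s) - E (next i) s) x.
    by have := nrm_ge0 (alpha (w i s) - w (next i) s); nra.
move=> [N _ /(_ N (leqnn N))] h.
by exists (f N), (w^~ N), (D^~ N).
Qed.

End CyclicFrames.

(** * Roots of unity *)

Section RootsOfUnity.
Context {R : realType}.
Implicit Types (x y : R) (z : R[i]).

Definition cis x : R[i] := cos x +i* sin x.

Lemma cis0 : cis 0 = 1.
Proof. by rewrite /cis cos0 sin0. Qed.

Lemma cisD x y : cis (x + y) = cis x * cis y.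
Proof. by rewrite /cis cosD sinD; simpc; congr (_ +i* _); rewrite addrC. Qed.

Lemma cisX x n : cis x ^+ n = cis (x * n%:R).
Proof.
elim: n => [|n IHn]; first by rewrite mulr0 cis0.
by rewrite exprS IHn -cisD -natr1 mulrDr mulr1 addrC.
Qed.

Lemma conjc_cis x : conjc (cis x) = cis (- x).
Proof. by rewrite /cis cosN sinN. Qed.

Lemma cis_eq1 x : cis x = 1 -> 0 < x < pi *+ 2 -> False.
Proof.
move=> c1 x0; have s0 : sin (x / 2) = 0.
  have : cos (x / 2 + x / 2) = 1.
    by rewrite (_ : x / 2 + x / 2 = x); [case: c1|lra].
  rewrite cosD -!expr2 cos2sin2 => h.
  have /eqP : sin (x / 2) ^+ 2 = 0 by lra.
  by rewrite sqrf_eq0 => /eqP.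
have := @sin_gt0_pi _ (x / 2); rewrite s0 ltxx => h; apply: notF; apply: h.
by apply/andP; split; lra.
Qed.

(** Continuity of the circle parametrization at [0], with real and imaginary
    parts kept apart as [nrm_diagonal] needs them. *)
Lemma cis_near1 (c : R) : 0 < c ->
  exists2 d, 0 < d & forall x, `|x| < d ->
    `|complex.Re (cis x - 1)| < c /\ `|complex.Im (cis x - 1)| < c.
Proof.
move=> c0.
have [/= d1 d10 h1] := (@cvgr_dist_lt _ _ _ _ _ _ _ (@continuous_cos R 0) c c0).
have [/= d2 d20 h2] := (@cvgr_dist_lt _ _ _ _ _ _ _ (@continuous_sin R 0) c c0).
exists (Num.min d1 d2); first by rewrite lt_min d10.
move=> x; rewrite lt_min => /andP[x1 x2].
have := h1 x; have := h2 x; rewrite /ball_ /= !sub0r !normrN cos0 sin0 sub0r normrN.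
by move=> /(_ x2) ? /(_ x1) ?; rewrite /= oppr0 addr0 distrC.
Qed.

Lemma conjcX z n : conjc (z ^+ n) = conjc z ^+ n.
Proof. exact: rmorphXn. Qed.

Definition unitary_primitive_root N z : Prop :=
  [/\ conjc z * z = 1, z ^+ N = 1 &
      forall j, (0 < j < N)%N -> z ^+ j <> 1].

Lemma cis_root_of_unity N : (0 < N)%N -> unitary_primitive_root N (cis (pi *+ 2 / N%:R)).
Proof.
move=> N0; have N0' : (0 : R) < N%:R by rewrite ltr0n.
split.
- by rewrite conjc_cis -cisD addNr cis0.
- rewrite cisX mulfVK ?gt_eqF//.
  by rewrite mulr2n cisD /cis cospi sinpi; simpc.
- move=> j /andP[j0 jN]; rewrite cisX => /cis_eq1; apply.
  have p0 := @pi_gt0 R; have j0' : (0 : R) < j%:R by rewrite ltr0n.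
  apply/andP; split.
    by rewrite mulr_gt0// divr_gt0// mulrn_wgt0.
  by rewrite mulrAC ltr_pdivrMr// ltr_pM2l ?ltr_nat// mulrn_wgt0.
Qed.

Lemma conjc_root_of_unity N z :
  unitary_primitive_root N z -> unitary_primitive_root N (conjc z).
Proof.
move=> [zz zN zj]; split.
- by rewrite conjcK mulrC.
- by rewrite -conjcX zN conjc1.
- move=> j jN zj1; apply: (zj j jN); apply: (can_inj (@conjcK R)).
  by rewrite conjc1 -zj1 conjcX.
Qed.

Lemma root_of_unity_mod N z i t : unitary_primitive_root N z ->
  z ^+ ((i %% N) * t) = z ^+ (i * t).
Proof.
move=> [_ zN _]; rewrite [in RHS](divn_eq i N) mulnDl exprD.
by rewrite mulnAC [(_ * N)%N]mulnC (exprM _ N) zN expr1n mul1r.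
Qed.

(** Orthogonality of the characters of the cyclic group of order [N]. *)
Lemma root_of_unity_sum N z i j : unitary_primitive_root N z -> (i < N)%N -> (j < N)%N ->
  \sum_(t < N) conjc (z ^+ (t * i)) * z ^+ (t * j) = if i == j then N%:R else 0.
Proof.
move=> [zz zN zj] iN jN; pose u := conjc (z ^+ i) * z ^+ j.
have zzX n : conjc (z ^+ n) * z ^+ n = 1.
  by rewrite conjcX -exprMn zz expr1n.
rewrite (eq_bigr (fun t : 'I_N => u ^+ t)) => [|t _]; last first.
  by rewrite /u exprMn -conjcX -!exprM mulnC [(t * j)%N]mulnC.
case: eqVneq => [ij|ij].
  rewrite /u ij zzX; under eq_bigr do rewrite expr1n.
  by rewrite sumr_const card_ord.
have uN : u ^+ N = 1.
  by rewrite /u exprMn -conjcX -!exprM ![(_ * N)%N]mulnC !exprM zN !expr1n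
    conjc1 mulr1.
have u1 : u - 1 != 0.
  rewrite subr_eq0; apply/eqP => u1.
  have zij : z ^+ i = z ^+ j.
    by rewrite -[LHS]mulr1 -u1 /u mulrA [z ^+ i * _]mulrC zzX mul1r.
  have := ij; rewrite neq_ltn => /orP[lt|lt].
    apply: (zj (j - i)%N); first by rewrite subn_gt0 lt (leq_ltn_trans (leq_subr _ _)).
    by rewrite -[LHS]mul1r -(zzX i) -mulrA -exprD subnKC ?(ltnW lt)// -zij zzX.
  apply: (zj (i - j)%N); first by rewrite subn_gt0 lt (leq_ltn_trans (leq_subr _ _)).
  by rewrite -[LHS]mul1r -(zzX j) -mulrA -exprD subnKC ?(ltnW lt)// zij zzX.
by apply: (mulfI u1); rewrite mulr0 -subrX1 uN subrr.
Qed.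

End RootsOfUnity.

(** * Discrete Fourier transform of a frame *)

Section Fourier.
Context {R : realType} {A : cstarAlgType R}.
Implicit Types (f : A) (x P : nat -> A) (c d : nat -> R[i]) (r : nat -> R).

Lemma frame_combination f N x c d : frame f N x ->
  star (\sum_(t < N) c t *: x t) * (\sum_(t < N) d t *: x t) =
  (\sum_(t < N) conjc (c t) * d t) *: f.
Proof.
move=> fr; rewrite star_sum mulr_suml scaler_suml; apply: eq_bigr => t _.
rewrite mulr_sumr (bigD1 t)//= big1 ?addr0 => [|s st].
  by rewrite starZc balgZl balgZr scalerA fr// eqxx.
rewrite starZc balgZl balgZr fr// ifF ?scaler0//.
by rewrite eq_sym; exact: negbTE.
Qed.

Definition fourier N (z : R[i]) x j : A :=
  ((Num.sqrt N%:R)^-1)%:C *: \sum_(t < N) z ^+ (t * j) *: x t.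

Lemma realc_nat n : (n%:R : R)%:C = n%:R :> R[i].
Proof. exact: (rmorph_nat (real_complex R)). Qed.

Lemma sqrt_natK N : (0 < N)%N ->
  ((Num.sqrt N%:R)^-1)%:C * (((Num.sqrt N%:R)^-1)%:C * N%:R) = 1 :> R[i].
Proof.
move=> N0; rewrite -realc_nat -!realCM mulrA -invfM -expr2 sqr_sqrtr ?ler0n//.
by rewrite mulVf// pnatr_eq0 -lt0n.
Qed.

Lemma fourier_frame f N z x : unitary_primitive_root N z -> frame f N x ->
  frame f N (fourier N z x).
Proof.
move=> zN fr i j iN jN; rewrite /fourier starZr balgZl balgZr scalerA.
rewrite (frame_combination (fun t => z ^+ (t * i)) (fun t => z ^+ (t * j)) fr).
rewrite (root_of_unity_sum zN)// scalerA; case: eqP => _; last by rewrite mulr0 scale0r.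
by rewrite -mulrA sqrt_natK ?scale1r// (leq_ltn_trans _ iN).
Qed.

(** The Fourier transform is a unitary change of basis, so it does not change
    the span. *)
Lemma fourier_sum N z x : unitary_primitive_root N z ->
  \sum_(j < N) fourier N z x j * star (fourier N z x j) =
  \sum_(j < N) x j * star (x j).
Proof.
case: N => [|N] zN; first by rewrite !big_ord0.
pose q : R[i] := ((Num.sqrt N.+1%:R)^-1)%:C.
rewrite (eq_bigr (fun j : 'I_N.+1 => \sum_(t < N.+1) \sum_(s < N.+1)
    (q * (q * (conjc (z ^+ (j * s)) * z ^+ (j * t)))) *: (x t * star (x s)))); last first.
  move=> j _; rewrite /fourier starZr balgZl balgZr star_sum mulr_suml.
  rewrite !scaler_sumr; apply: eq_bigr => t _.
  rewrite mulr_sumr !scaler_sumr; apply: eq_bigr => s _.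
  rewrite starZc balgZl balgZr !scalerA -/q; congr (_ *: _).
  by rewrite -!mulrA [(j * s)%N]mulnC [(j * t)%N]mulnC [conjc _ * _]mulrC.
rewrite exchange_big /=; apply: eq_bigr => t _; rewrite exchange_big /=.
rewrite [LHS](bigD1 t)//= [X in _ + X]big1 ?addr0 => [|s st].
  rewrite -scaler_suml -!mulr_sumr (root_of_unity_sum zN)// eqxx.
  by rewrite sqrt_natK// scale1r.
rewrite -scaler_suml -!mulr_sumr (root_of_unity_sum zN)// ifF ?mulr0 ?scale0r//.
exact: negbTE.
Qed.

Lemma diagonal_mul N P c d : orthogonal_projections N P ->
  (\sum_(t < N) c t *: P t) * (\sum_(t < N) d t *: P t) =
  \sum_(t < N) (c t * d t) *: P t.
Proof.
move=> [pP oP]; rewrite mulr_suml; apply: eq_bigr => t _.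
rewrite mulr_sumr (bigD1 t)//= big1 ?addr0 => [|s st].
  by rewrite balgZl balgZr scalerA (proj2 (pP t _)).
rewrite balgZl balgZr oP ?scaler0//.
by apply: contra_neq st => ts; apply/esym/val_inj.
Qed.

Lemma star_diagonal N P c : orthogonal_projections N P ->
  star (\sum_(t < N) c t *: P t) = \sum_(t < N) conjc (c t) *: P t.
Proof.
move=> [pP _]; rewrite star_sum; apply: eq_bigr => t _.
by rewrite starZc (proj1 (pP t _)).
Qed.

(** After division by [e] the entries [r] lie between [-1] and [1], and such a
    number is the real part of [r +i* sqrt (1 - r ^ 2)], of modulus [1].  Hence
    the element is the real part of a diagonal partial isometry, which bounds
    its norm independently of [N]. *)
Lemma nrm_diagonal_real N P r (e : R) : orthogonal_projections N P -> 0 < e ->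
  (forall t, (t < N)%N -> `|r t| <= e) ->
  nrm (\sum_(t < N) (r t)%:C *: P t) <= e.
Proof.
move=> oP e0 re; pose v t : R[i] := (r t / e) +i* Num.sqrt (1 - (r t / e) ^+ 2).
pose V := \sum_(t < N) v t *: P t.
have vv t : (t < N)%N -> conjc (v t) * v t = 1.
  move=> /re; rewrite ler_norml => /andP[h1 h2].
  have h : 0 <= 1 - (r t / e) ^+ 2.
    rewrite subr_ge0 -[leRHS](expr1n _ 2) -[leLHS]real_normK ?num_real//.
    rewrite ler_pXn2r ?nnegrE//.
    by rewrite ler_norml ler_pdivrMr// ler_pdivlMr// mulN1r mul1r h1.
  rewrite /v; simpc; congr (_ +i* _); last by rewrite mulrC subrr.
  by rewrite -!expr2 sqr_sqrtr// addrC subrK.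
have V1 : nrm V <= 1.
  apply: nrm_partial_isometry; rewrite /V (star_diagonal v oP).
  rewrite (diagonal_mul (fun t => conjc (v t)) v oP).
  rewrite (eq_bigr (fun t : 'I_N => 1 *: P t)) => [|t _]; last by rewrite vv.
  split.
    rewrite (star_diagonal (fun=> 1) oP); apply: eq_bigr => t _.
    by congr (_ *: _); exact: conjc1.
  rewrite (diagonal_mul (fun=> 1) (fun=> 1) oP); apply: eq_bigr => t _.
  by congr (_ *: _); exact: mulr1.
have -> : \sum_(t < N) (r t)%:C *: P t = (e / 2)%:C *: (V + star V).
  rewrite /V (star_diagonal v oP) -big_split scaler_sumr; apply: eq_bigr => t _ /=.
  rewrite -scalerDl scalerA; congr (_ *: _); rewrite /v; simpc.
  by congr (_ +i* _); field; rewrite gt_eqF.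
have e2 : 0 <= e / 2 by rewrite divr_ge0// ltW.
rewrite nrmZr ger0_norm//.
have h : nrm (V + star V) <= 2 by have := nrmD V (star V); rewrite nrm_star; lra.
by nra.
Qed.

Lemma nrm_diagonal N P c (e : R) : orthogonal_projections N P -> 0 < e ->
  (forall t, (t < N)%N -> `|complex.Re (c t)| <= e /\ `|complex.Im (c t)| <= e) ->
  nrm (\sum_(t < N) c t *: P t) <= 2 * e.
Proof.
move=> oP e0 ce; pose i : R[i] := 0 +i* 1.
have -> : \sum_(t < N) c t *: P t =
    \sum_(t < N) (complex.Re (c t))%:C *: P t +
    i *: \sum_(t < N) (complex.Im (c t))%:C *: P t.
  rewrite scaler_sumr -big_split; apply: eq_bigr => t _ /=.
  by rewrite scalerA -scalerDl; congr (_ *: _); case: (c t) => a b; rewrite /i; simpc.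
rewrite (le_trans (nrmD _ _))// mulr_natl mulr2n lerD//.
  by apply: (@nrm_diagonal_real N P (fun t => complex.Re (c t))) => // t /ce[].
have -> : nrm (i *: \sum_(t < N) (complex.Im (c t))%:C *: P t) =
    nrm (\sum_(t < N) (complex.Im (c t))%:C *: P t).
  apply: complexI; rewrite -!nrmE normrZ normc_def /= expr0n expr1n add0r sqrtr1.
  by rewrite mul1r.
by apply: (@nrm_diagonal_real N P (fun t => complex.Im (c t))) => // t /ce[].
Qed.

End Fourier.

(** * Fourier transforms of cyclic frames *)

Section TwoTowers.
Context {R : realType} {A : cstarAlgType R}.
Implicit Types (F : set A) (b f : A) (w D P Q : nat -> A).

Lemma frame_consP f N w : is_projection f ->
  frame f N.+1 (frame_cons f w) <->
  frame f N w /\ forall i, (i < N)%N -> f * w i = 0.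
Proof.
move=> [sf ff]; split=> [fr|[fr fw] [|i] [|j] iN jN].
- split=> [i j iN jN|i iN]; first by have := fr i.+1 j.+1 iN jN.
  by rewrite -[f]sf; exact: (fr 0%N i.+1).
- by rewrite /= sf ff.
- by rewrite /= sf; exact: fw.
- by rewrite /= -[LHS]starK starM starK sf fw// star0.
- exact: fr.
Qed.

Lemma fourier_ann f N z w j : (forall i, (i < N)%N -> f * w i = 0) ->
  f * fourier N z w j = 0.
Proof.
move=> fw; rewrite balgZr mulr_sumr big1 ?scaler0// => t _.
by rewrite balgZr fw// scaler0.
Qed.

Lemma star_fourier N (z : R[i]) w j :
  star (fourier N z w j) = fourier N (conjc z) (fun t => star (w t)) j.
Proof.
rewrite starZr star_sum; congr (_ *: _); apply: eq_bigr => t _.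
by rewrite starZc conjcX.
Qed.

Lemma approx_fourier N z (x y : nat -> nat -> A) j :
  (forall t, (t < N)%N -> approx (x t) (y t)) ->
  approx (fun s => fourier N z (x^~ s) j) (fun s => fourier N z (y^~ s) j).
Proof.
move=> xy; apply: approxZ; apply: (@approx_sum _ _ N
  (fun t s => z ^+ (t * j) *: x t s) (fun t s => z ^+ (t * j) *: y t s)) => t tN.
exact/approxZ/xy.
Qed.

Lemma approx_fourier_comm N z b (x : nat -> nat -> A) j :
  (forall t, (t < N)%N -> approx (fun s => b * x t s) (fun s => x t s * b)) ->
  approx (fun s => b * fourier N z (x^~ s) j) (fun s => fourier N z (x^~ s) j * b).
Proof.
move=> xb; apply: (@approx_trans _ _
  (fun s => fourier N z (fun t => b * x t s) j)).
  apply: approx_eqW => s; rewrite balgZr mulr_sumr; congr (_ *: _).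
  by apply: eq_bigr => t _; rewrite balgZr.
apply: (@approx_trans _ _ (fun s => fourier N z (fun t => x t s * b) j)).
  exact: (approx_fourier _ _ xb).
apply: approx_eqW => s; rewrite balgZl mulr_suml; congr (_ *: _).
by apply: eq_bigr => t _; rewrite balgZl.
Qed.

(** The discrete Fourier transform of a cyclically permuted family consists
    of eigenvectors of the permutation. *)
Lemma fourier_cycle N (z : R[i]) w j : (0 < N)%N -> unitary_primitive_root N z ->
  fourier N (conjc z) (fun i => w (i.+1 %% N)%N) j =
  z ^+ j *: fourier N (conjc z) w j.
Proof.
move=> N0 zN; have zcN := conjc_root_of_unity zN.
rewrite /fourier [RHS]scalerA mulrC -scalerA; congr (_ *: _).
pose T i : A := z ^+ j *: (conjc z ^+ (i * j) *: w i).
rewrite scaler_sumr.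
have := @block_shift _ _ N 1 T 0 N0 isT; rewrite /block modnn muln1.
rewrite (eq_bigr (fun i : 'I_N => conjc z ^+ (i * j) *: w (i.+1 %% N)%N)) => [->|i _].
  by apply: eq_bigr => i _; rewrite muln1 addn0.
rewrite /T muln1 addn0 (root_of_unity_mod _ _ zcN) mulSn exprD !scalerA mulrA.
by have [zz _ _] := zN; rewrite -exprMn [z * _]mulrC zz expr1n mul1r.
Qed.

Lemma fourier_aut alpha N z w j : is_automorphism alpha ->
  alpha (fourier N z w j) = fourier N z (fun t => alpha (w t)) j.
Proof.
move=> ha; rewrite (autZ ha) (aut_sum ha); congr (_ *: _).
by apply: eq_bigr => t _; rewrite (autZ ha).
Qed.

Lemma diagonal_frame f N (c : nat -> R[i]) w j : is_projection f ->
  frame f N w -> (j < N)%N ->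
  (\sum_(t < N) c t *: (w t * star (w t))) * w j = c j *: w j.
Proof.
move=> pf fr jN; rewrite mulr_suml (bigD1 (Ordinal jN))//= big1 ?addr0.
  by rewrite balgZl -mulrA fr// eqxx (frame_absorb pf fr).
move=> t tj; rewrite balgZl -mulrA fr// ifF ?mulr0 ?scaler0//.
by apply: contra_neqF tj => /eqP tj; exact/val_inj.
Qed.

Variable alpha : A -> A.
Hypothesis halpha : is_automorphism alpha.
Hypothesis towers : has_approximate_towers alpha.

Lemma cyclic_frame_sequences F K : (0 < K)%N -> finite_set F ->
  exists (f : nat -> A) (w D : nat -> nat -> A),
  [/\ forall s, [/\ is_projection (f s),
        frame (f s) K.+1 (frame_cons (f s) (w^~ s)),
        orthogonal_projections K (D^~ s) &
        f s + \sum_(i < K) w i s * star (w i s) + \sum_(i < K) D i s = 1],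
      approx (fun s => alpha (f s)) f,
      forall i, (i < K)%N -> approx (fun s => alpha (w i s)) (w (i.+1 %% K)%N),
      forall i, (i < K)%N -> approx (fun s => alpha (D i s)) (D (i.+1 %% K)%N) &
      forall b, F b -> approx (fun s => b * f s) (fun s => f s * b) /\
        forall i, (i < K)%N ->
        [/\ approx (fun s => b * w i s) (fun s => w i s * b),
            approx (fun s => b * star (w i s)) (fun s => star (w i s) * b) &
            approx (fun s => b * D i s) (fun s => D i s * b)]].
Proof.
move=> K0 finF.
have /choice [h hP] s : exists h : A * ((nat -> A) * (nat -> A)),
    cyclic_frame alpha F K s.+1%:R^-1 h.1 h.2.1 h.2.2.
  have [|f [w [D fwD]]] := exists_cyclic_frame halpha towers K0 finF (e := s.+1%:R^-1).
    by rewrite invr_gt0.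
  by exists (f, (w, D)).
exists (fun s => (h s).1), (fun i s => (h s).2.1 i), (fun i s => (h s).2.2 i).
split.
- by move=> s; have [] := hP s.
- by apply: approx_inv => s; have [] := hP s.
- by move=> i iK; apply: approx_inv => s; have [_ _ h1 _ _] := hP s; exact: h1.
- by move=> i iK; apply: approx_inv => s; have [_ _ _ h1 _] := hP s; exact: h1.
- move=> b Fb; split; first by apply: approx_inv => s; have [_ _ _ _ /(_ b Fb)[]] := hP s.
  move=> i iK; split; apply: approx_inv => s;
    by have [_ _ _ _ /(_ b Fb)[_ /(_ i iK)[]]] := hP s.
Qed.

Definition approximate_tower F k (e : R) P : Prop :=
  [/\ forall j, (j < k)%N -> is_projection (P j),
      forall j, (j < k)%N -> nrm (alpha (P j) - P (j.+1 %% k)%N) < e &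
      forall b j, F b -> (j < k)%N -> nrm (b * P j - P j * b) < e].

Lemma near_approximate_tower F k e (T : nat -> nat -> A) : finite_set F -> 0 < e ->
  (\forall s \near \oo, forall j, (j < k)%N -> is_projection (T j s)) ->
  (\forall s \near \oo, forall j, (j < k)%N ->
    nrm (alpha (T j s) - T (j.+1 %% k)%N s) < e) ->
  (forall b j, F b -> (j < k)%N -> approx (fun s => b * T j s) (fun s => T j s * b)) ->
  \forall s \near \oo, approximate_tower F k e (T^~ s).
Proof.
move=> finF e0 pT aT Tb.
have c : \forall s \near \oo, forall b, F b -> forall j, (j < k)%N ->
    nrm (b * T j s - T j s * b) < e.
  apply: near_forall_finite => // b Fb; apply: near_forall_lt => j jk.
  exact: (Tb b j Fb jk e e0).
by apply: filterS3 pT aT c => s h1 h2 h3; split=> // b j Fb jk; exact: h3.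
Qed.

(** The bound does not depend on [p]: this is why sums of many projections of
    a tower can be taken without loss. *)
Lemma nrm_near_unitary_conj (z p : A) (c : R) : is_projection p ->
  nrm z <= 2 * c -> c <= 4^-1 -> nrm ((1 + z) * p * star (1 + z) - p) <= 5 * c.
Proof.
move=> pp zc c4; have p1 := nrm_projection pp.
have -> : (1 + z) * p * star (1 + z) - p = z * p * star (1 + z) + p * star z.
  rewrite [(1 + z) * p]mulrDl mul1r mulrDl starD star1 {1}mulrDr mulr1.
  by rewrite addrC !addrA addNr add0r addrC.
have h1 := nrmD (z * p * star (1 + z)) (p * star z).
have h2 := nrmM (z * p) (star (1 + z)); have h3 := nrmM z p.
have h4 := nrmM p (star z); have h5 := nrmD 1 z; have h6 := @nrm_1 R A.
rewrite !nrm_star in h2 h4.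
have z0 := nrm_ge0 z; have p0 := nrm_ge0 p; have u0 := nrm_ge0 (1 + z).
have h7 : nrm (z * p) <= 2 * c by nra.
have h8 : nrm (1 + z) <= 3 / 2 by lra.
have h9 : nrm (p * star z) <= 2 * c by nra.
have h10 : nrm (z * p) * nrm (1 + z) <= 2 * c * (3 / 2).
  by apply: ler_pM => //; exact: nrm_ge0.
lra.
Qed.

End TwoTowers.

(** * The two towers *)

Section RegularTower.
Context {R : realType} {A : cstarAlgType R}.
Implicit Types (F : set A) (b : A).
Variable alpha : A -> A.
Hypothesis halpha : is_automorphism alpha.

(** The eigenvectors [X t] are [f], with eigenvalue [1], and the Fourier
    transforms of [w], with eigenvalues [om ^+ t].  Their transform [g]
    of order [K + 1] would be permuted cyclically if the eigenvalue of [X t]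
    were [zt ^+ t]; multiplying [X t] by the ratio [mu t] of the actual
    eigenvalue to this one is the action of the element [1 + z], which is
    close to [1] in norm. *)
Lemma regular_tower F K (c : R) (om zt : R[i]) (f : nat -> A) (w : nat -> nat -> A) :
  (0 < K)%N -> 0 < c -> unitary_primitive_root K om -> unitary_primitive_root K.+1 zt ->
  (forall t, (t < K)%N ->
    `|complex.Re (om ^+ t * conjc zt ^+ t.+1 - 1)| <= c /\
    `|complex.Im (om ^+ t * conjc zt ^+ t.+1 - 1)| <= c) ->
  (forall s, is_projection (f s)) ->
  (forall s, frame (f s) K.+1 (frame_cons (f s) (w^~ s))) ->
  approx (fun s => alpha (f s)) f ->
  (forall i, (i < K)%N -> approx (fun s => alpha (w i s)) (w (i.+1 %% K)%N)) ->
  (forall b, F b -> approx (fun s => b * f s) (fun s => f s * b) /\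
     forall i, (i < K)%N ->
       approx (fun s => b * w i s) (fun s => w i s * b) /\
       approx (fun s => b * star (w i s)) (fun s => star (w i s) * b)) ->
  exists (G : nat -> nat -> A) (z : nat -> A),
  [/\ forall s, orthogonal_projections K.+1 (G^~ s) /\
        \sum_(j < K.+1) G j s = f s + \sum_(i < K) w i s * star (w i s),
      forall s, nrm (z s) <= 2 * c,
      forall j, (j < K.+1)%N -> approx (fun s => alpha (G j s))
        (fun s => (1 + z s) * G (j.+1 %% K.+1)%N s * star (1 + z s)) &
      forall b j, F b -> (j < K.+1)%N ->
        approx (fun s => b * G j s) (fun s => G j s * b)].
Proof.
move=> K0 c0 omK ztK ztc pf fr alphaf alphaw comm.
have omcK := conjc_root_of_unity omK.
pose x i s := fourier K (conjc om) (w^~ s) i.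
pose X t s := frame_cons (f s) (x^~ s) t.
have frX s : frame (f s) K.+1 (X^~ s).
  have [frw fw] := (frame_consP K (w^~ s) (pf s)).1 (fr s).
  apply/(frame_consP _ _ (pf s)); split; first exact: fourier_frame.
  by move=> i _; exact: fourier_ann.
pose la t := if t is t'.+1 then om ^+ t' else 1.
have alphaX t : (t < K.+1)%N -> approx (fun s => alpha (X t s)) (fun s => la t *: X t s).
  case: t => [_|t tK].
    by apply: approx_trans alphaf _; apply: approx_eqW => s; rewrite scale1r.
  apply: (@approx_trans _ _ (fun s => fourier K (conjc om) (fun i => alpha (w i s)) t)).
    by apply: approx_eqW => s; rewrite fourier_aut.
  apply: (@approx_trans _ _
    (fun s => fourier K (conjc om) (fun i => w (i.+1 %% K)%N s) t)).
    exact: (approx_fourier _ _ alphaw).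
  by apply: approx_eqW => s; rewrite (fourier_cycle (w^~ s) _ K0 omK).
pose mu t := la t * conjc zt ^+ t.
pose z s := \sum_(t < K.+1) (mu t - 1) *: (X t s * star (X t s)).
pose g j s := fourier K.+1 zt (X^~ s) j.
have zX s t : (t < K.+1)%N -> (1 + z s) * X t s = mu t *: X t s.
  move=> tK; rewrite mulrDl mul1r (diagonal_frame (fun t => mu t - 1) (pf s) (frX s))//.
  by rewrite scalerBl scale1r addrC subrK.
have zc s : nrm (z s) <= 2 * c.
  apply: (nrm_diagonal (c := fun t => mu t - 1) (frame_projections (pf s) (frX s)) c0).
  case=> [_|t tK]; last exact: ztc.
  by rewrite /mu expr0 mulr1 subrr /= normr0 ltW.
have bu : bounded_seq (fun s => 1 + z s).
  exists (1 + 2 * c); apply: nearW => s.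
  by rewrite (le_trans (nrmD _ _))// lerD ?nrm_1.
have frg s : frame (f s) K.+1 (g^~ s) by exact: fourier_frame.
have alphag j : approx (fun s => alpha (g j s))
    (fun s => (1 + z s) * g (j.+1 %% K.+1)%N s).
  apply: (@approx_trans _ _ (fun s => fourier K.+1 zt (fun t => alpha (X t s)) j)).
    by apply: approx_eqW => s; rewrite /g fourier_aut.
  apply: (@approx_trans _ _ (fun s => fourier K.+1 zt (fun t => la t *: X t s) j)).
    exact: (approx_fourier _ _ alphaX).
  apply: approx_eqW => s; rewrite /g balgZr mulr_sumr; congr (_ *: _).
  apply: eq_bigr => t _; rewrite balgZr zX// !scalerA; congr (_ *: _).
  rewrite [(t * (_ %% _))%N]mulnC (root_of_unity_mod _ _ ztK) mulSn exprD /mu.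
  have [zz _ _] := ztK.
  have ztt : conjc zt ^+ t * zt ^+ t = 1 by rewrite -exprMn zz expr1n.
  rewrite [zt ^+ t * _]mulrC -!mulrA [(t * j)%N]mulnC; congr (_ * _).
  by rewrite mulrCA [zt ^+ t * _]mulrC ztt mulr1.
have bg j : (j < K.+1)%N -> bounded_seq (g j).
  by move=> jK; exists 1; apply: nearW => s; exact: (frame_nrm (pf s) (frg s)).
exists (fun j s => g j s * star (g j s)), z; split=> //.
- move=> s; split; first exact: (frame_projections (pf s) (frg s)).
  rewrite (fourier_sum (X^~ s) ztK) big_ord_recl /=; have [sf ff] := pf s.
  by rewrite sf ff (fourier_sum (w^~ s) omcK).
- move=> j jK; have nK : (j.+1 %% K.+1 < K.+1)%N by rewrite ltn_mod.
  have bug : bounded_seq (fun s => (1 + z s) * g (j.+1 %% K.+1)%N s).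
    by apply: boundedM => //; exact: bg.
  apply: (@approx_trans _ _ (fun s => alpha (g j s) * star (alpha (g j s)))).
    by apply: approx_eqW => s; rewrite (autM halpha) (aut_star halpha).
  apply: (@approx_trans _ _ (fun s => ((1 + z s) * g (j.+1 %% K.+1)%N s) *
      star ((1 + z s) * g (j.+1 %% K.+1)%N s))).
    apply: approxM; [exact/bounded_aut/bg|exact: bounded_star|exact: alphag|].
    exact/approx_star/alphag.
  by apply: approx_eqW => s; rewrite starM !mulrA.
- move=> b j Fb jK; have [bfc bwc] := comm b Fb.
  have sf s : star (f s) = f s by case: (pf s).
  apply: approx_commM; [exact: bg|exact/bounded_star/bg| |].
    apply: approx_fourier_comm => -[_|t tK] //.
    by apply: approx_fourier_comm => i iK; exact: (bwc i iK).1.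
  apply: (@approx_trans _ _ (fun s => b * fourier K.+1 (conjc zt)
      (fun t => star (X t s)) j)).
    by apply: approx_eqW => s; rewrite star_fourier.
  apply: (@approx_trans _ _ (fun s => fourier K.+1 (conjc zt)
      (fun t => star (X t s)) j * b)); last first.
    by apply: approx_eqW => s; rewrite star_fourier.
  apply: (approx_fourier_comm _ _ (x := fun t s => star (X t s))) => -[_|t tK].
    apply: (@approx_trans _ _ (fun s => b * f s)).
      by apply: approx_eqW => s; rewrite /= sf.
    by apply: approx_trans bfc _; apply: approx_eqW => s; rewrite /= sf.
  apply: (@approx_trans _ _ (fun s => b * fourier K (conjc (conjc om))
      (fun t => star (w t s)) t)).
    by apply: approx_eqW => s; rewrite /= star_fourier.
  apply: (@approx_trans _ _ (fun s => fourier K (conjc (conjc om))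
      (fun t => star (w t s)) t * b)); last first.
    by apply: approx_eqW => s; rewrite /= star_fourier.
  apply: (approx_fourier_comm _ _ (x := fun t s => star (w t s))) => i iK.
  exact: (bwc i iK).2.
Qed.

(** The angle between [om ^+ t] and [zt ^+ t.+1] is
    [2 * pi / K * ((K - t) / (K + 1))], which is less than [2 * pi / K]. *)
Lemma roots_matching (c d : R) K t : 0 < d -> (t < K)%N ->
  pi *+ 2 / d < K%:R ->
  (forall x : R, `|x| < d ->
    `|complex.Re (cis x - 1)| < c /\ `|complex.Im (cis x - 1)| < c) ->
  let om := cis (pi *+ 2 / K%:R) in let zt := cis (pi *+ 2 / K.+1%:R) in
  `|complex.Re (om ^+ t * conjc zt ^+ t.+1 - 1)| <= c /\
  `|complex.Im (om ^+ t * conjc zt ^+ t.+1 - 1)| <= c.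
Proof.
move=> d0 tK Kd hc om zt; rewrite /om /zt conjc_cis !cisX -cisD.
suff /hc[/ltW ? /ltW ?] :
  `|pi *+ 2 / K%:R * t%:R + - (pi *+ 2 / K.+1%:R) * t.+1%:R| < d by [].
have K0 : (0 : R) < K%:R by rewrite ltr0n (leq_ltn_trans _ tK).
have t0 : (0 : R) <= t%:R by rewrite ler0n.
have tK' : (t%:R : R) <= K%:R by rewrite ler_nat ltnW.
have p0 := @pi_gt0 R.
rewrite -!natr1 mulr2n; rewrite mulr2n in Kd.
have -> : (pi + pi) / K%:R * t%:R + - ((pi + pi) / (K%:R + 1)) * (t%:R + 1)
    = - ((pi + pi) / K%:R * ((K%:R - t%:R) / (K%:R + 1))) :> R.
  by field; apply/andP; split; rewrite gt_eqF//; lra.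
rewrite normrN ger0_norm; last first.
  by rewrite mulr_ge0// divr_ge0//; lra.
apply: le_lt_trans (_ : (pi + pi) / K%:R < d).
  rewrite ler_piMr//; first by rewrite divr_ge0//; lra.
  by rewrite ler_pdivrMr; lra.
by rewrite ltr_pdivrMr// mulrC -ltr_pdivrMr.
Qed.

Hypothesis towers : has_approximate_towers alpha.

(** The towers [D] and [G] of lengths [K] and [K + 1] are wrapped around cycles
    of lengths [k] and [k + 1], independent of [F] and [e]. *)
Lemma two_towers F k (e : R) : (0 < k)%N -> finite_set F -> 0 < e ->
  exists P Q : nat -> A,
    [/\ approximate_tower alpha F k e P, approximate_tower alpha F k.+1 e Q &
        \sum_(j < k) P j + \sum_(j < k.+1) Q j = 1].
Proof.
move=> k0 finF e0; pose c : R := Num.min 4^-1 (e / 16).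
have c0 : 0 < c by rewrite lt_min; apply/andP; split; lra.
have c4 : c <= 4^-1 by rewrite ge_min lexx.
have ce : 5 * c < e / 2.
  have : c <= e / 16 by rewrite ge_min lexx orbT.
  by lra.
have [d d0 dc] := cis_near1 c0.
pose T := Num.bound (pi *+ 2 / d).
(* [K = 0] modulo [k] and [K = -1] modulo [k + 1] *)
pose n0 := (1 + k.+1 * T)%N; pose n1 := (k * T + 1)%N; pose K := (n0 * k)%N.
have K1 : K.+1 = (n1 * k.+1)%N by rewrite /K /n0 /n1; nia.
have K0 : (0 < K)%N by rewrite muln_gt0 k0.
have Kd : pi *+ 2 / d < K%:R.
  apply: lt_le_trans (archi_boundP _) _.
    by apply: divr_ge0; [exact/mulrn_wge0/pi_ge0|exact: ltW].
  by rewrite ler_nat -/T /K /n0; nia.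
have [f [w [D [exact_ alphaf alphaw alphaD comm]]]] :=
  cyclic_frame_sequences halpha towers K0 finF.
have pf s : is_projection (f s) by case: (exact_ s).
have fr s : frame (f s) K.+1 (frame_cons (f s) (w^~ s)) by case: (exact_ s).
have [|G [z [Gex zc alphaG Gcomm]]] := regular_tower (F := F) K0 c0
  (@cis_root_of_unity R K K0) (@cis_root_of_unity R K.+1 (ltn0Sn K))
  (fun t tK => roots_matching d0 tK Kd dc) pf fr alphaf alphaw.
  move=> b Fb; have [bf bw] := comm b Fb; split=> // i iK.
  by have [] := bw i iK.
pose P j s := block n0 k (D^~ s) j; pose Q j s := block n1 k.+1 (G^~ s) j.
have pP s j : (j < k)%N -> is_projection (P j s).
  move=> jk; have [_ _ oD _] := exact_ s.
  by apply: (proj1 (block_projections oD)).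
have pQ s j : (j < k.+1)%N -> is_projection (Q j s).
  move=> jk; have [oG _] := Gex s; rewrite K1 in oG.
  by apply: (proj1 (block_projections oG)).
have towerP : \forall s \near \oo, approximate_tower alpha F k e (P^~ s).
  apply: near_approximate_tower => //.
  - by apply: nearW => s j; exact: pP.
  - apply: near_forall_lt => j jk.
    exact: (approx_block_aut halpha _ jk alphaD).
  - move=> b j Fb jk; apply: approx_block_comm => // i iK.
    by have [_ /(_ i iK) []] := comm b Fb.
have towerQ : \forall s \near \oo, approximate_tower alpha F k.+1 e (Q^~ s).
  apply: near_approximate_tower => //.
  - by apply: nearW => s j; exact: pQ.
  - apply: near_forall_lt => j jk.
    have Qu : approx (fun s => alpha (Q j s))
        (fun s => (1 + z s) * Q (j.+1 %% k.+1)%N s * star (1 + z s)).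
      apply: (@approx_trans _ _ (fun s => block n1 k.+1
          (fun i => (1 + z s) * G i s * star (1 + z s)) (j.+1 %% k.+1)%N)).
        apply: (approx_block_aut halpha (T := G)
          (S := fun i s => (1 + z s) * G i s * star (1 + z s))) => //.
          by rewrite /n1 addn1.
        by rewrite -K1.
      apply: approx_eqW => s; rewrite /Q /block mulr_sumr mulr_suml.
      by apply: eq_bigr.
    have e2 : 0 < e / 2 by lra.
    apply: filterS (Qu _ e2) => s h.
    have jk' := ltn_pmod j.+1 (ltn0Sn k).
    have := nrm_near_unitary_conj (pQ s _ jk') (zc s) c4.
    have := nrm_dist_triangle ((1 + z s) * Q (j.+1 %% k.+1)%N s * star (1 + z s))
      (alpha (Q j s)) (Q (j.+1 %% k.+1)%N s).
    by lra.
  - move=> b j Fb jk; apply: approx_block_comm => // i iK.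
    by apply: Gcomm => //; rewrite K1.
have [N _ hN] : \forall s \near \oo, approximate_tower alpha F k e (P^~ s) /\
    approximate_tower alpha F k.+1 e (Q^~ s).
  by apply: filterS2 towerP towerQ.
have [hP hQ] := hN N (leqnn N).
exists (P^~ N), (Q^~ N); split=> //.
rewrite !block_sum -K1 -/K (proj2 (Gex N)) addrC.
by have [] := exact_ N.
Qed.

End RegularTower.

Theorem theorem3p3 (R : realType) (A : cstarAlgType R) (alpha : A -> A)
    (halpha : is_automorphism alpha)
    (h : forall (F : set A) (m : nat) (m_gt0 : (0 < m)%N) (eps : R),
      finite_set F -> 0 < eps ->
      exists (e : 'I_m -> A) (p : A),
        let e0 := e (Ordinal m_gt0) in
        [/\ (forall i, is_projection (e i)) /\ is_partial_isometry p,
            forall i j, i != j -> `|e i * e j| < eps%:C,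
            forall i, `|alpha (e i) - e (ordS i)| < eps%:C,
            `|star p * p - (1 - \sum_(i < m) e i)| < eps%:C
              /\ `|p * star p - e0| < eps%:C &
            forall x y, F x -> y = e0 \/ y = p -> `|commutator x y| < eps%:C]) :
  rohlin_property alpha.
Proof.
move=> k k0; exists 2, (fun i => k + i)%N; split=> // [i|F eps finF eps0].
  by rewrite addn_gt0 k0 leq_addr.
have [P [Q [towerP towerQ PQ1]]] := two_towers halpha h k0 finF eps0.
pose T (i : 'I_2) := if i == ord0 then P else Q.
have tower (i : 'I_2) : approximate_tower alpha F (k + i) eps (T i).
  by case: i => -[|[|//]] /= i2; rewrite /T ?addn0 ?addn1.
exists (fun i j => T i j); split.
- by move=> i j; have [pT _ _] := tower i; exact: pT.
- rewrite big_ord_recl big_ord1 -PQ1 /T /=; congr (_ + _).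
    by rewrite addn0.
  by rewrite addn1.
- move=> i j; rewrite ltnrm; have [_ aT _] := tower i.
  exact: (aT j (ltn_ord j)).
- move=> i j x Fx; rewrite ltnrm; have [_ _ cT] := tower i.
  exact: cT.
Qed.
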